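(* Let $X,Y$ be computable metric spaces and let $F:\subseteq X\to Y$ be limit computable. Then the restriction of $F$ to the set of $1$-generic points $x\in X$ (i.e. to $\{x\in\mathrm{dom}(F):x$ is $1$-generic in $X\}$) is computable relative to the halting problem.
   Context: A computable metric space $(X,d,\alpha)$ is a metric space $(X,d)$ with a dense sequence $\alpha:\mathbb{N}\to X$ such that $d\circ(\alpha\times\alpha):\mathbb{N}^2\to\mathbb{R}$ is a computable (double) sequence of reals. It is represented by its Cauchy representation $\delta_X:\subseteq\mathbb{N}^{\mathbb{N}}\to X$, $\delta_X(p):=\lim_{n\to\infty}\alpha p(n)$ with $\mathrm{dom}(\delta_X)=\{p:(\forall k)(\forall n\geq k)\;d(\alpha p(n),\alpha p(k))<2^{-k}$ and $(\alpha p(n))_n$ converges$\}$. A partial function $f:\subseteq X\to Y$ between computable metric spaces is limit computable, or computable relative to the halting problem, if it has a realizer with that property, i.e. such an $R:\subseteq\mathbb{N}^{\mathbb{N}}\to\mathbb{N}^{\mathbb{N}}$ with $\delta_YR(p)=f\delta_X(p)$ for all $p\in\mathrm{dom}(f\delta_X)$. A partial function $R:\subseteq\mathbb{N}^{\mathbb{N}}\to\mathbb{N}^{\mathbb{N}}$ is computable if there is a Turing machine (infinite input tape, one-way output tape) that on each $p\in\mathrm{dom}(R)$ produces $R(p)$ in the long run; it is limit computable if there is a Turing machine with a two-way output tape (it may revise its output) that on each $p\in\mathrm{dom}(R)$ computes $R(p)$ such that each output position $n$ has, after finitely many steps, the content $R(p)(n)$ and is never changed again; it is computable relative to $q\in\mathbb{N}^{\mathbb{N}}$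 if there is a computable $G$ with $R(p)=G\langle q,p\rangle$ for all $p\in\mathrm{dom}(R)$, where $\langle q,p\rangle(2n):=q(n)$, $\langle q,p\rangle(2n+1):=p(n)$. Nothing is required outside $\mathrm{dom}(R)$. The halting problem $0'\in\mathbb{N}^{\mathbb{N}}$ is given by $0'(i)=1$ if the $i$-th Turing machine halts on input $000\dots$, and $0'(i)=0$ otherwise. In a computable metric space $(X,d,\alpha)$ let $B_{\langle c,r\rangle}:=\{x\in X:d(x,\alpha(c))<\overline{r}\}$ for $c,r\in\mathbb{N}$, where $\langle\cdot,\cdot\rangle$ is the Cantor pairing and $\overline{\langle i,j,k\rangle}:=\frac{i-j}{k+1}$ encodes rationals via a standard triple coding. Let $W_i:=\{n\in\mathbb{N}:$ the $i$-th Turing machine halts on input $n\}$ and $U_i:=\bigcup_{n\in W_i}B_n$. Let $\mathsf{J}_X:X\to\mathbb{N}^{\mathbb{N}}$ with $\mathsf{J}_X(x)(i):=1$ if $x\in U_i$ and $0$ otherwise. A point $x\in X$ is called $1$-generic if $\mathsf{J}_X$ is continuous at $x$. *)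

(* Defs.v *)
From Stdlib Require Import Bool Reals List Arith ZArith Cantor ClassicalEpsilon Lia.
Import ListNotations.

Definition baire : Type := nat -> nat.

Record pfun (A B : Type) : Type := Pfun {
  graph :> A -> B -> Prop;
  graph_fun : forall a b b', graph a b -> graph a b' -> b = b' }.

Program Definition restrict {A B : Type} (f : pfun A B) (P : A -> Prop) :
  pfun A B := {| graph := fun a b => P a /\ f a b |}.
Next Obligation. eapply graph_fun; eauto. Qed.

(** * Turing machines

    Multi-tape machines with deterministic finite control; each step acts on
    one tape, as in the flowcharts of Type-2 machines.  Tape 0 is the read-only
    input tape, tape 1 the output tape, and all others are work tapes, of which
    a machine can use only the finitely many named in its rules.  Likewise
    states and symbols are numbers, but only finitely many occur in the rules.
    Tapes are two-sided infinite, heads start on cell 0, and the initial state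
    is 0.  The first applicable rule is executed; the machine halts when no
    rule applies. *)

Inductive move : Type := Left | Stay | Right.

Record rule : Type := Rule {
  source : nat;
  tape : nat;
  read : nat;
  write : nat;
  shift : move;
  target : nat }.

Definition machine : Type := list rule.

Definition input_tape : nat := 0.
Definition output_tape : nat := 1.

Definition blank : nat := 0.
Definition stroke : nat := 1.
Definition comma : nat := 2.

Record config : Type := Config {
  state : nat;
  head : nat -> Z;
  cell : nat -> Z -> nat }.

Definition applicable (c : config) (r : rule) : bool :=
  (source r =? state c) && (read r =? cell c (tape r) (head c (tape r))).

Definition displacement (m : move) : Z :=
  match m with Left => (-1)%Z | Stay => 0%Z | Right => 1%Z end.

Definition execute (r : rule) (c : config) : config :=
  {| state := target r;
     head := fun j =>
       if j =? tape r then (head c j + displacement (shift r))%Z else head c j;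
     cell := fun j z =>
       if (j =? tape r) && negb (j =? input_tape) && (z =? head c j)%Z
       then write r else cell c j z |}.

Definition step (M : machine) (c : config) : config :=
  match find (applicable c) M with
  | Some r => execute r c
  | None => c
  end.

Definition initial (input : Z -> nat) : config :=
  {| state := 0;
     head := fun _ => 0%Z;
     cell := fun j z => if j =? input_tape then input z else blank |}.

Definition run (M : machine) (input : Z -> nat) (t : nat) : config :=
  Nat.iter t (step M) (initial input).

Definition halted (M : machine) (c : config) : Prop :=
  find (applicable c) M = None.

Definition halts (M : machine) (input : Z -> nat) : Prop :=
  exists t, halted M (run M input t).

(** With a one-way output tape, the head moves right after every access to that
    tape, so that no cell is revisited.  Without this restriction the output
    tape is two-way. *)
Definition one_way (M : machine) : Prop :=
  forall r, In r M -> tape r = output_tape -> shift r = Right.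

(** Symbol [m] of the infinite word [1^(p 0) , 1^(p 1) , 1^(p 2) , ...]. *)
Fixpoint unary (p : baire) (m : nat) : nat :=
  match m with
  | 0 => match p 0 with 0 => comma | S _ => stroke end
  | S m' =>
      match p 0 with
      | 0 => unary (fun n => p (S n)) m'
      | S a => unary (fun n => match n with 0 => a | S _ => p n end) m'
      end
  end.

Definition seq_word (p : baire) (z : Z) : nat :=
  if (z <? 0)%Z then blank else unary p (Z.to_nat z).

Definition num_word (n : nat) (z : Z) : nat :=
  if (0 <=? z)%Z && (z <? Z.of_nat n)%Z then stroke else blank.

(** Every cell of the output tape eventually has its final content, and these
    contents spell [q].  For one-way machines a written cell is final. *)
Definition produces (M : machine) (p q : baire) : Prop :=
  forall m, exists t0, forall t, t0 <= t ->
    cell (run M (seq_word p) t) output_tape (Z.of_nat m) = unary q m.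

(** * Computability on Baire space and on the natural numbers *)

Definition computable (R : pfun baire baire) : Prop :=
  exists M, one_way M /\ forall p q, R p q -> produces M p q.

Definition limit_computable (R : pfun baire baire) : Prop :=
  exists M, forall p q, R p q -> produces M p q.

Definition join (q p : baire) : baire :=
  fun n => if Nat.even n then q (Nat.div2 n) else p (Nat.div2 n).

Definition computable_relative_to (q : baire) (R : pfun baire baire) : Prop :=
  exists G : pfun baire baire,
    computable G /\ forall p r, R p r -> G (join q p) r.

Definition computable_nat (f : nat -> nat) : Prop :=
  exists M, one_way M /\ forall n, exists t,
    halted M (run M (num_word n) t) /\
    forall m : nat,
      cell (run M (num_word n) t) output_tape (Z.of_nat m)
      = num_word (f n) (Z.of_nat m).

(** * Numbering of the machines *)

Definition move_of (n : nat) : move :=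
  match n with 0 => Left | 1 => Stay | _ => Right end.

(** The number of a rule is [<s, <j, <a, <b, <m, s'>>>>>]. *)
Definition rule_of (n : nat) : rule :=
  let (s, n) := of_nat n in
  let (j, n) := of_nat n in
  let (a, n) := of_nat n in
  let (b, n) := of_nat n in
  let (m, s') := of_nat n in
  Rule s j a b (move_of m) s'.

(** [0] codes the empty list and [S <a, b>] the list with head [a] and tail [b];
    the first argument is recursion fuel. *)
Fixpoint rules_of (fuel n : nat) : machine :=
  match fuel, n with
  | S fuel, S n => let (a, b) := of_nat n in rule_of a :: rules_of fuel b
  | _, _ => []
  end.

Definition machine_of (i : nat) : machine := rules_of i i.

Lemma rule_of_surj (r : rule) : exists n, rule_of n = r.
Proof.
  destruct r as [s j a b m s'].
  assert (Hm : exists k, move_of k = m)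
    by (destruct m; [exists 0 | exists 1 | exists 2]; reflexivity).
  destruct Hm as [k <-].
  exists (to_nat (s, to_nat (j, to_nat (a, to_nat (b, to_nat (k, s')))))).
  unfold rule_of; rewrite !cancel_of_to; reflexivity.
Qed.

Lemma rules_of_surj (M : machine) :
  exists n, forall fuel, n <= fuel -> rules_of fuel n = M.
Proof.
  induction M as [|r M [b Hb]].
  - exists 0; intros [|fuel] _; reflexivity.
  - destruct (rule_of_surj r) as [a <-].
    exists (S (to_nat (a, b))); intros [|fuel] Hle; [lia|].
    assert (Hba := to_nat_non_decreasing a b).
    cbn [rules_of]; rewrite cancel_of_to, Hb by lia; reflexivity.
Qed.

Lemma machine_of_surj (M : machine) : exists i, machine_of i = M.
Proof. destruct (rules_of_surj M) as [n Hn]; exists n; apply Hn; lia. Qed.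

Definition halting_problem : baire := fun i =>
  if excluded_middle_informative (halts (machine_of i) (seq_word (fun _ => 0)))
  then 1 else 0.

Definition W (i n : nat) : Prop := halts (machine_of i) (num_word n).

(** * Computable metric spaces *)

(** The rational [(i - j) / (k + 1)] coded by [<i, j, k> = <<i, j>, k>]. *)
Definition rational (r : nat) : R :=
  let (ij, k) := of_nat r in
  let (i, j) := of_nat ij in
  ((INR i - INR j) / (INR k + 1))%R.

Coercion Base : Metric_Space >-> Sortclass.
Arguments dist {m} _ _.

Definition dense_sequence (X : Metric_Space) (a : nat -> X) : Prop :=
  forall (x : X) (eps : R), (0 < eps)%R -> exists n, (dist x (a n) < eps)%R.

Definition computable_double_sequence (u : nat -> nat -> R) : Prop :=
  exists f : nat -> nat, computable_nat f /\
    forall i j k,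
      (Rabs (rational (f (to_nat (to_nat (i, j), k))) - u i j) < (/ 2) ^ k)%R.

Record computable_metric_space : Type := ComputableMetricSpace {
  space :> Metric_Space;
  alpha : nat -> space;
  alpha_dense : dense_sequence space alpha;
  alpha_computable :
    computable_double_sequence (fun i j => dist (alpha i) (alpha j)) }.

Arguments alpha {_} _.

(** [delta p x] is the graph of the Cauchy representation: [p] is in its domain
    and names [x]. *)
Definition delta {X : computable_metric_space} (p : baire) (x : X) : Prop :=
  (forall k n, k <= n -> (dist (alpha (p n)) (alpha (p k) : X) < (/ 2) ^ k)%R) /\
  (forall eps : R, (0 < eps)%R ->
     exists N, forall n, N <= n -> (dist (alpha (p n)) x < eps)%R).

Definition realizer {X Y : computable_metric_space}
    (R : pfun baire baire) (f : pfun X Y) : Prop :=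
  forall p x y, delta p x -> f x y -> exists q, R p q /\ delta q y.

Definition limit_computable_map {X Y : computable_metric_space}
    (f : pfun X Y) : Prop :=
  exists R, realizer R f /\ limit_computable R.

Definition computable_map_relative_to {X Y : computable_metric_space}
    (q : baire) (f : pfun X Y) : Prop :=
  exists R, realizer R f /\ computable_relative_to q R.

(** * 1-generic points *)

Definition ball (X : computable_metric_space) (n : nat) (x : X) : Prop :=
  let (c, r) := of_nat n in (dist x (alpha c) < rational r)%R.

Definition U (X : computable_metric_space) (i : nat) (x : X) : Prop :=
  exists n, W i n /\ ball X n x.

Definition J (X : computable_metric_space) (x : X) : baire := fun i =>
  if excluded_middle_informative (U X i x) then 1 else 0.

(** Continuity for the product topology on Baire space. *)
Definition continuous_at {X : Metric_Space} (f : X -> baire) (x : X) : Prop :=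
  forall k, exists eps : R, (0 < eps)%R /\
    forall y, (dist y x < eps)%R -> forall i, i < k -> f y i = f x i.

Definition one_generic (X : computable_metric_space) (x : X) : Prop :=
  continuous_at (J X) x.

(* Main.v *)
(** The name of a 1-generic point [x] is replaced by one that is generic enough
    for the limit machine [M].  Words [s] are extended such that [x] keeps a name
    extending them.  Suppose that output cell [m] of [M] is being settled.  The
    points with a name extending [s] on which [M] revises cell [m] form a
    c.e. open set, so by 1-genericity [x] either lies in this set, and then a
    suitable extension of [s] is found by search, or has a neighbouring ball
    disjoint from this set, which the halting problem can certify; in the latter
    case the present content of cell [m] is final.  The first case cannot occur
    infinitely often for one [m], as the words then form a name of [x] on which
    [M] does not converge.

    Turing machines for this are compiled from primitive recursive terms that
    may read the input word; one scheme of machines, which iterate a function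
    and emit symbols on the way, yields the c.e. sets, the queries to the
    halting problem and the final machine. *)

From Stdlib Require Import Bool Reals List Arith ZArith Cantor.
From Stdlib Require Import ClassicalEpsilon FunctionalExtensionality Lia Lra.
Require Import Defs.
Import ListNotations.

(** * Flowcharts *)

(** Genericity speaks about points, but a limit machine works on names, and a name of a 1-generic
    point may carry arbitrary further information. Since [F] depends on the point alone, the
    realizer may answer for any other name of [x]; it therefore builds its own. The construction
    only asks about finite data: a word, a cell and a ball. Such a question is c.e. and independent
    of the name, so one bit of the halting problem answers it, while the name is used only to
    confirm that [x] lies in the ball. Two conventions keep this finite: a word of length n is run
    for n steps, in which no machine can read beyond it, and its letters stay strictly within half
    of the tolerance of a name, so that compatibility with [x] is an open condition. *)

Definition deterministic (M : machine) : Prop :=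
  forall r r', In r M -> In r' M -> source r = source r' ->
    tape r = tape r' /\ (read r = read r' -> r = r').

(** With at most one applicable rule, the place of a rule in the list does not matter, so fragments
    of machines can be concatenated. Rules of one state must share their tape, as rules for two
    tapes could apply at once. *)
Lemma step_rule (M : machine) (c : config) (r : rule) :
  deterministic M -> In r M -> source r = state c ->
  read r = cell c (tape r) (head c (tape r)) -> step M c = execute r c.
Proof.
  intros HM Hr Hs Hc; unfold step.
  assert (Ha : applicable c r = true)
    by (unfold applicable; rewrite Hs, Hc, !Nat.eqb_refl; reflexivity).
  destruct (find (applicable c) M) as [r'|] eqn:E.
  - apply find_some in E; destruct E as [Hr' Ha'].
    unfold applicable in Ha'; apply andb_true_iff in Ha'.
    rewrite !Nat.eqb_eq in Ha'; destruct Ha' as [Hs' Hc'].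
    destruct (HM r r' Hr Hr') as [Ht Heq]; [congruence|].
    rewrite Heq; [reflexivity|congruence].
  - rewrite (find_none _ _ E r Hr) in Ha; discriminate.
Qed.

Definition upd (v : nat -> nat) (r n : nat) : nat -> nat :=
  fun j => if j =? r then n else v j.

Ltac upd_tac :=
  repeat match goal with
  | |- context [?a =? ?b] => destruct (Nat.eqb_spec a b)
  | H : context [?a =? ?b] |- _ => destruct (Nat.eqb_spec a b)
  end; subst; try lia; auto;
  try match goal with
  | H : forall j, _ <= j -> ?v j = 0 |- ?v _ = 0 => apply H; lia
  end.

Ltac upd_ext := apply functional_extensionality; intros ?j; unfold upd; upd_tac.

Inductive cmd : Type :=
  | Skip
  | Inc (r : nat)
  | Seq (a b : cmd)
  | Loop (r : nat) (a : cmd)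
  | If (r : nat) (a b : cmd)
  | Seek (m : move)
  | Case (a b : cmd)
  | Emit (a : nat).

(** [Loop r a] and [If r a b] decrement a nonzero register [r] before they run
    [a], respectively [b]; [Case a b] runs [a] on a stroke under the input head
    and [b] on a comma. *)
Inductive exec (inp : Z -> nat) : cmd -> (nat -> nat) -> nat -> list nat ->
    (nat -> nat) -> nat -> list nat -> Prop :=
  | exec_skip v h o : exec inp Skip v h o v h o
  | exec_inc r v h o : exec inp (Inc r) v h o (upd v r (S (v r))) h o
  | exec_seq a b v h o v' h' o' v'' h'' o'' :
      exec inp a v h o v' h' o' -> exec inp b v' h' o' v'' h'' o'' ->
      exec inp (Seq a b) v h o v'' h'' o''
  | exec_loop_zero r a v h o : v r = 0 -> exec inp (Loop r a) v h o v h o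
  | exec_loop_succ r a n v h o v' h' o' v'' h'' o'' :
      v r = S n -> exec inp a (upd v r n) h o v' h' o' ->
      exec inp (Loop r a) v' h' o' v'' h'' o'' ->
      exec inp (Loop r a) v h o v'' h'' o''
  | exec_if_zero r a b v h o v' h' o' :
      v r = 0 -> exec inp a v h o v' h' o' -> exec inp (If r a b) v h o v' h' o'
  | exec_if_succ r a b n v h o v' h' o' :
      v r = S n -> exec inp b (upd v r n) h o v' h' o' ->
      exec inp (If r a b) v h o v' h' o'
  | exec_right v h o : exec inp (Seek Right) v h o v (S h) o
  | exec_left v h o : exec inp (Seek Left) v (S h) o v h o
  | exec_case_blank a b v h o :
      inp (Z.of_nat h) = blank -> exec inp (Case a b) v h o v h o
  | exec_case_stroke a b v h o v' h' o' :
      inp (Z.of_nat h) = stroke -> exec inp a v h o v' h' o' ->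
      exec inp (Case a b) v h o v' h' o'
  | exec_case_comma a b v h o v' h' o' :
      inp (Z.of_nat h) = comma -> exec inp b v h o v' h' o' ->
      exec inp (Case a b) v h o v' h' o'
  | exec_emit a v h o : exec inp (Emit a) v h o v h (o ++ [a]).

Fixpoint size (c : cmd) : nat :=
  match c with
  | Inc _ => 2
  | Seq a b => size a + size b
  | Loop _ a => 1 + size a
  | If _ a b | Case a b => 1 + size a + size b
  | Skip | Seek _ | Emit _ => 1
  end.

(** The rules for [c] with entry state [s] and exit state [x]; they use the
    states from [s] to [s + size c - 1]. *)
Fixpoint assemble (c : cmd) (s x : nat) : machine :=
  match c with
  | Skip => map (fun a => Rule s 2 a a Stay x) [blank; stroke]
  | Inc r =>
      map (fun a => Rule s (2 + r) a a Right (S s)) [blank; stroke] ++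
      map (fun a => Rule (S s) (2 + r) a stroke Stay x) [blank; stroke]
  | Seq a b => assemble a s (s + size a) ++ assemble b (s + size a) x
  | Loop r a =>
      [Rule s (2 + r) blank blank Stay x; Rule s (2 + r) stroke stroke Left (S s)]
      ++ assemble a (S s) s
  | If r a b =>
      [Rule s (2 + r) blank blank Stay (S s);
       Rule s (2 + r) stroke stroke Left (S s + size a)]
      ++ assemble a (S s) x ++ assemble b (S s + size a) x
  | Seek m => map (fun a => Rule s input_tape a a m x) [blank; stroke; comma]
  | Case a b =>
      [Rule s input_tape blank blank Stay x;
       Rule s input_tape stroke stroke Stay (S s);
       Rule s input_tape comma comma Stay (S s + size a)]
      ++ assemble a (S s) x ++ assemble b (S s + size a) x
  | Emit a => [Rule s output_tape blank a Right x]
  end.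

(** Subcommands occupy disjoint intervals of states; this makes the assembled machine deterministic
    and leaves states outside the interval free for other rules. *)
Lemma assemble_source (c : cmd) : forall s x r,
  In r (assemble c s x) -> s <= source r < s + size c.
Proof.
  induction c; cbn [assemble size]; intros s x r' H; cbn [map app] in H;
    rewrite ?in_app_iff in H; cbn [In] in H; rewrite ?in_app_iff in H;
    repeat match goal with
    | H : _ \/ _ |- _ => destruct H
    | H : Rule _ _ _ _ _ _ = _ |- _ => subst r'; cbn [source]
    | IH : forall s x r, In r (assemble ?c s x) -> _,
      H : In _ (assemble ?c _ _) |- _ => apply IH in H
    | H : False |- _ => destruct H
    end; lia.
Qed.

Lemma deterministic_app (M N : machine) :
  deterministic M -> deterministic N ->
  (forall r r', In r M -> In r' N -> source r <> source r') ->
  deterministic (M ++ N).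
Proof.
  intros HM HN Hd r r' Hr Hr' E; rewrite in_app_iff in Hr, Hr'.
  destruct Hr as [Hr|Hr], Hr' as [Hr'|Hr'].
  - apply HM; assumption.
  - destruct (Hd r r' Hr Hr' E).
  - destruct (Hd r' r Hr' Hr (eq_sym E)).
  - apply HN; assumption.
Qed.

Ltac det_base :=
  intros ? ? H H'; cbn [map app In] in H, H';
  repeat match goal with
  | H : _ \/ _ |- _ => destruct H
  | H : False |- _ => destruct H
  end; subst; cbn; intros; split; try reflexivity; try lia; try discriminate.

Lemma assemble_deterministic (c : cmd) : forall s x,
  deterministic (assemble c s x).
Proof.
  induction c; intros s x; cbn [assemble];
    repeat (apply deterministic_app; auto); try (now det_base);
    intros r0 r1 H H'; rewrite ?in_app_iff in H';
    repeat match goal with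
    | H : In _ (assemble _ _ _) |- _ => apply assemble_source in H
    | H : _ \/ _ |- _ => destruct H
    | H : In _ _ |- _ =>
        cbn [map app In] in H; decompose [or] H; clear H; subst; cbn [source] in *
    end; try tauto; try lia.
Qed.

(** Register [j] is kept on tape [2 + j]: its value is the position of the head,
    and blank is read on cell 0 but a stroke on all cells up to the head, so that
    the symbol under the head tests for zero. *)
Record represents (inp : Z -> nat) (c : config) (s : nat) (v : nat -> nat)
    (h : nat) (o : list nat) : Prop := {
  rep_state : state c = s;
  rep_input : forall z, cell c input_tape z = inp z;
  rep_input_head : head c input_tape = Z.of_nat h;
  rep_output : forall m, cell c output_tape (Z.of_nat m) = nth m o blank;
  rep_output_head : head c output_tape = Z.of_nat (length o);
  rep_head : forall j, head c (2 + j) = Z.of_nat (v j);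
  rep_zero : forall j, cell c (2 + j) 0%Z = blank;
  rep_below : forall j z, (0 < z <= Z.of_nat (v j))%Z -> cell c (2 + j) z = stroke;
  rep_symbol : forall j z, (0 <= z)%Z ->
    cell c (2 + j) z = blank \/ cell c (2 + j) z = stroke }.

Ltac cbn_execute :=
  unfold execute, input_tape, output_tape in *;
  cbn [execute head cell state source tape read write shift target displacement
       Nat.eqb Nat.add andb negb] in *.

Ltac cell_cases :=
  repeat match goal with
  | |- context [?a =? ?b] => destruct (Nat.eqb_spec a b); subst
  | H : context [?a =? ?b] |- _ => destruct (Nat.eqb_spec a b); subst
  | |- context [(?a =? ?b)%Z] => destruct (Z.eqb_spec a b); subst
  end; cbn [andb negb].

(** * Correctness of assembled machines *)

Section Simulation.
Variables (inp : Z -> nat) (M : machine).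
Hypothesis inp_symbol : forall z, inp z = blank \/ inp z = stroke \/ inp z = comma.
Hypothesis M_det : deterministic M.

Lemma step_zero (c : config) s v h o r x :
  represents inp c s v h o -> v r = 0 ->
  In (Rule s (2 + r) blank blank Stay x) M ->
  represents inp (step M c) x v h o.
Proof.
  intros Hc E Hr.
  assert (Hh := rep_head _ _ _ _ _ _ Hc r); rewrite E in Hh.
  rewrite (step_rule M c _ M_det Hr);
    [|symmetry; apply (rep_state _ _ _ _ _ _ Hc)
     |cbn [read tape]; rewrite Hh; symmetry; apply (rep_zero _ _ _ _ _ _ Hc)].
  destruct Hc; split; intros; cbn_execute; auto; rewrite ?Hh; cell_cases; auto; try lia.
Qed.

Lemma step_decrement (c : config) s v h o r n x :
  represents inp c s v h o -> v r = S n ->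
  In (Rule s (2 + r) stroke stroke Left x) M ->
  represents inp (step M c) x (upd v r n) h o.
Proof.
  intros Hc E Hr.
  assert (Hh := rep_head _ _ _ _ _ _ Hc r); rewrite E in Hh.
  rewrite (step_rule M c _ M_det Hr);
    [|symmetry; apply (rep_state _ _ _ _ _ _ Hc)
     |cbn [read tape]; rewrite Hh; symmetry; apply (rep_below _ _ _ _ _ _ Hc); lia].
  destruct Hc; unfold upd; split; intros; cbn_execute; auto;
    rewrite ?Hh; cell_cases; auto; try lia; apply rep_below0; lia.
Qed.

(** A decrement moves the head left and erases nothing, so the next cell may hold a blank or an old
    stroke; hence the two variants of each rule. *)
Lemma step_increment (c : config) s s' v h o r x :
  represents inp c s v h o ->
  incl (map (fun a => Rule s (2 + r) a a Right s') [blank; stroke] ++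
        map (fun a => Rule s' (2 + r) a stroke Stay x) [blank; stroke]) M ->
  represents inp (step M (step M c)) x (upd v r (S (v r))) h o.
Proof.
  intros Hc Hi.
  assert (Hh := rep_head _ _ _ _ _ _ Hc r).
  assert (exists a, In (Rule s (2 + r) a a Right s') M /\
    a = cell c (2 + r) (Z.of_nat (v r))) as (a & Ha & E).
  { destruct (rep_symbol _ _ _ _ _ _ Hc r (Z.of_nat (v r))) as [E|E];
      [lia|exists blank|exists stroke];
      (split; [apply Hi; cbn; auto|symmetry; exact E]). }
  rewrite (step_rule M c _ M_det Ha);
    [|symmetry; apply (rep_state _ _ _ _ _ _ Hc)|cbn_execute; rewrite Hh; exact E].
  set (c' := execute _ c).
  assert (Hc' : forall j z, cell c' j z = cell c j z).
  { intros j z; unfold c'; cbn_execute; cell_cases; auto.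
    f_equal; symmetry; exact Hh. }
  assert (Hh' : forall j, head c' j =
    if j =? 2 + r then Z.of_nat (S (v r)) else head c j).
  { intros j; unfold c'; cbn_execute; cell_cases; lia. }
  assert (exists b, In (Rule s' (2 + r) b stroke Stay x) M /\
    b = cell c' (2 + r) (head c' (2 + r))) as (b & Hb & E').
  { rewrite Hc', Hh', Nat.eqb_refl.
    destruct (rep_symbol _ _ _ _ _ _ Hc r (Z.of_nat (S (v r)))) as [E'|E'];
      [lia|exists blank|exists stroke];
      (split; [apply Hi; cbn; auto|symmetry; exact E']). }
  rewrite (step_rule M c' _ M_det Hb); [|reflexivity|exact E'].
  clearbody c'.
  destruct Hc; unfold upd; split; intros; cbn_execute;
    rewrite ?Hc', ?Hh', ?Nat.eqb_refl; cbn_execute; auto; cell_cases; auto; try lia;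
    try (apply rep_below0; lia).
Qed.

Lemma step_skip (c : config) s v h o x :
  represents inp c s v h o ->
  incl (map (fun a => Rule s 2 a a Stay x) [blank; stroke]) M ->
  represents inp (step M c) x v h o.
Proof.
  intros Hc Hi.
  assert (Hh := rep_head _ _ _ _ _ _ Hc 0).
  assert (exists a, In (Rule s 2 a a Stay x) M /\
    a = cell c 2 (Z.of_nat (v 0))) as (a & Ha & E).
  { destruct (rep_symbol _ _ _ _ _ _ Hc 0 (Z.of_nat (v 0))) as [E|E];
      [lia|exists blank|exists stroke];
      (split; [apply Hi; cbn; auto|symmetry; exact E]). }
  rewrite (step_rule M c _ M_det Ha);
    [|symmetry; apply (rep_state _ _ _ _ _ _ Hc)|cbn_execute; rewrite Hh; exact E].
  set (c' := execute _ c).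
  assert (Hc' : forall j z, cell c' j z = cell c j z).
  { intros j z; unfold c'; cbn_execute; cell_cases; auto.
    f_equal; symmetry; exact Hh. }
  assert (Hh' : forall j, head c' j = head c j).
  { intros j; unfold c'; cbn_execute; cell_cases; lia. }
  assert (Hs : state c' = x) by reflexivity.
  clearbody c'.
  destruct Hc; split; intros; rewrite ?Hc', ?Hh'; auto.
Qed.

Lemma step_input (c : config) s v h o a m x h' :
  represents inp c s v h o -> inp (Z.of_nat h) = a ->
  In (Rule s input_tape a a m x) M ->
  Z.of_nat h' = (Z.of_nat h + displacement m)%Z ->
  represents inp (step M c) x v h' o.
Proof.
  intros Hc E Ha Em.
  rewrite (step_rule M c _ M_det Ha);
    [|symmetry; apply (rep_state _ _ _ _ _ _ Hc)
     |cbn_execute; destruct Hc as [_ H1 H2]; cbn_execute;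
      rewrite H1, H2; symmetry; exact E].
  destruct Hc; split; intros; cbn_execute; cell_cases; auto; lia.
Qed.

Lemma step_emit (c : config) s v h o a x :
  represents inp c s v h o ->
  In (Rule s output_tape blank a Right x) M ->
  represents inp (step M c) x v h (o ++ [a]).
Proof.
  intros Hc Ha.
  assert (Hh := rep_output_head _ _ _ _ _ _ Hc).
  rewrite (step_rule M c _ M_det Ha);
    [|symmetry; apply (rep_state _ _ _ _ _ _ Hc)
     |cbn_execute; rewrite Hh; destruct Hc as [_ _ _ H]; cbn_execute;
      rewrite H, nth_overflow; [reflexivity|lia]].
  destruct Hc; split; intros; cbn_execute; cell_cases; auto.
  - rewrite Hh in e; apply Nat2Z.inj in e; subst m.
    rewrite app_nth2, Nat.sub_diag; [reflexivity|lia].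
  - rewrite Hh in n; rewrite rep_output0.
    destruct (lt_dec m (length o)).
    + rewrite app_nth1; [reflexivity|lia].
    + rewrite !nth_overflow; [reflexivity|rewrite length_app; cbn; lia|lia].
  - rewrite length_app; cbn [length]; lia.
Qed.

(** [exec] describes terminating executions only. The main loop of a machine that runs forever is
    not covered by it; [loop_reached] unrolls that loop one body at a time. *)
Theorem assemble_correct (k : cmd) v h o v' h' o' :
  exec inp k v h o v' h' o' -> forall s x c,
  incl (assemble k s x) M -> represents inp c s v h o ->
  exists t, represents inp (Nat.iter t (step M) c) x v' h' o'.
Proof.
  induction 1; cbn [assemble]; intros s x c Hi Hc;
    try (apply incl_app_inv in Hi as [Hi1 Hi2]).
  - exists 1; apply (step_skip c s); assumption.
  - exists 2; apply (step_increment c s (S s)); [assumption|].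
    apply incl_app; assumption.
  - destruct (IHexec1 _ _ _ Hi1 Hc) as [t Ht].
    destruct (IHexec2 _ _ _ Hi2 Ht) as [t' Ht'].
    exists (t' + t); rewrite Nat.iter_add; exact Ht'.
  - exists 1; apply (step_zero c s) with r; auto; apply Hi1; cbn; auto.
  - assert (H2 : represents inp (step M c) (S s) (upd v r n) h o)
      by (apply (step_decrement c s) ; auto; apply Hi1; cbn; auto).
    destruct (IHexec1 _ _ _ Hi2 H2) as [t Ht].
    destruct (IHexec2 s x _ (incl_app Hi1 Hi2) Ht) as [t' Ht'].
    exists (t' + (t + 1)); rewrite !Nat.iter_add; exact Ht'.
  - apply incl_app_inv in Hi2 as [Hi2 Hi3].
    assert (H2 : represents inp (step M c) (S s) v h o)
      by (apply (step_zero c s) with r ; auto; apply Hi1; cbn; auto).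
    destruct (IHexec _ _ _ Hi2 H2) as [t Ht].
    exists (t + 1); rewrite Nat.iter_add; exact Ht.
  - apply incl_app_inv in Hi2 as [Hi2 Hi3].
    assert (H2 : represents inp (step M c) (S s + size a) (upd v r n) h o)
      by (apply (step_decrement c s) ; auto; apply Hi1; cbn; auto).
    destruct (IHexec _ _ _ Hi3 H2) as [t Ht].
    exists (t + 1); rewrite Nat.iter_add; exact Ht.
  - exists 1; apply (step_input c s v h o (inp (Z.of_nat h)) Right); auto;
      [|cbn; lia].
    apply Hi; destruct (inp_symbol (Z.of_nat h)) as [E|[E|E]]; rewrite E; cbn; auto.
  - exists 1; apply (step_input c s v (S h) o (inp (Z.of_nat (S h))) Left); auto;
      [|cbn [displacement]; lia].
    apply Hi; destruct (inp_symbol (Z.of_nat (S h))) as [E|[E|E]];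
      rewrite E; cbn; auto.
  - exists 1; apply (step_input c s v h o blank Stay); auto; [|cbn; lia].
    apply Hi1; cbn; auto.
  - apply incl_app_inv in Hi2 as [Hi2 Hi3].
    assert (H2 : represents inp (step M c) (S s) v h o)
      by (apply (step_input c s v h o stroke Stay); auto;
          [apply Hi1; cbn; auto|cbn; lia]).
    destruct (IHexec _ _ _ Hi2 H2) as [t Ht].
    exists (t + 1); rewrite Nat.iter_add; exact Ht.
  - apply incl_app_inv in Hi2 as [Hi2 Hi3].
    assert (H2 : represents inp (step M c) (S s + size a) v h o)
      by (apply (step_input c s v h o comma Stay); auto;
          [apply Hi1; cbn; auto|cbn; lia]).
    destruct (IHexec _ _ _ Hi3 H2) as [t Ht].
    exists (t + 1); rewrite Nat.iter_add; exact Ht.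
  - exists 1; apply (step_emit c s); auto; apply Hi; cbn; auto.
Qed.
End Simulation.

(** The output head never returns to a cell that it has left. *)
Lemma one_way_final (M : machine) (c : config) (z : Z) (t : nat) :
  one_way M -> (z < head c output_tape)%Z ->
  (z < head (Nat.iter t (step M) c) output_tape)%Z /\
  cell (Nat.iter t (step M) c) output_tape z = cell c output_tape z.
Proof.
  intros HM Hz; induction t as [|t [IH1 IH2]]; [auto|cbn [Nat.iter nat_rect]].
  change (nat_rect (fun _ => config) c (fun _ => step M) t)
    with (Nat.iter t (step M) c).
  rewrite <- IH2; clear IH2; set (c' := Nat.iter t (step M) c) in *; clearbody c'.
  unfold step; destruct (find (applicable c') M) as [r|] eqn:E; [|auto].
  apply find_some in E; destruct E as [Hr _]; specialize (HM r Hr).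
  unfold execute; cbn [head cell].
  destruct (Nat.eqb_spec output_tape (tape r)) as [Et|Et]; [|auto].
  rewrite HM by auto; cbn [displacement]; split; [lia|].
  destruct (Z.eqb_spec z (head c' output_tape)); [lia|].
  rewrite andb_false_r; reflexivity.
Qed.

Lemma assemble_one_way (k : cmd) : forall s x, one_way (assemble k s x).
Proof.
  induction k; intros s x r0 Hr Ht; cbn [assemble] in Hr; rewrite ?in_app_iff in Hr;
    repeat match goal with
    | H : _ \/ _ |- _ => destruct H
    | IH : forall s x, one_way (assemble ?k s x), H : In _ (assemble ?k _ _) |- _ =>
        exact (IH _ _ _ H Ht)
    | H : In _ _ |- _ =>
        cbn [map app In] in H; decompose [or] H; clear H; subst; cbn in Ht |- *
    end; try reflexivity; try discriminate; try tauto.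
Qed.

(** * Primitive recursive terms *)

Definition scons (a : nat) (v : nat -> nat) : nat -> nat :=
  fun i => match i with 0 => a | S i => v i end.

(** Variables are de Bruijn indices; [Sym t] is the input symbol at position
    [t], and [Rec z s n] binds the counter and, innermost, the accumulator. *)
Inductive term : Type :=
  | Var (i : nat)
  | Zero
  | Succ (t : term)
  | Let (a b : term)
  | Rec (z s n : term)
  | Sym (t : term).

Fixpoint eval (inp : nat -> nat) (t : term) (v : nat -> nat) : nat :=
  match t with
  | Var i => v i
  | Zero => 0
  | Succ t => S (eval inp t v)
  | Let a b => eval inp b (scons (eval inp a v) v)
  | Rec z s n =>
      nat_rect (fun _ => nat) (eval inp z v)
        (fun k x => eval inp s (scons x (scons k v))) (eval inp n v)
  | Sym t => inp (eval inp t v)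
  end.

(** The value of [t] is added to register [d], where [G] gives the registers of
    the variables and the registers from [d] on are free. *)
Fixpoint compile (t : term) (G : nat -> nat) (d : nat) : cmd :=
  match t with
  | Var i => Seq (Loop (G i) (Seq (Inc d) (Inc (S d)))) (Loop (S d) (Inc (G i)))
  | Zero => Skip
  | Succ t => Seq (compile t G d) (Inc d)
  | Let a b =>
      Seq (compile a G d) (Seq (compile b (scons d G) (S d))
        (Seq (Loop d Skip) (Loop (S d) (Inc d))))
  | Rec z s n =>
      Seq (compile n G d) (Seq (compile z G (2 + d))
        (Seq (Loop d (Seq (compile s (scons (2 + d) (scons (1 + d) G)) (3 + d))
                (Seq (Loop (2 + d) Skip)
                  (Seq (Loop (3 + d) (Inc (2 + d))) (Inc (1 + d))))))
          (Seq (Loop (1 + d) Skip) (Loop (2 + d) (Inc d)))))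
  | Sym t =>
      Seq (compile t G d) (Seq (Loop d (Seq (Inc (S d)) (Seek Right)))
        (Seq (Case (Inc d) (Seq (Inc d) (Inc d))) (Loop (S d) (Seek Left))))
  end.

Lemma exec_eq (inp : Z -> nat) c v h o v' h' o' w :
  exec inp c v h o v' h' o' -> v' = w -> exec inp c v h o w h' o'.
Proof. intros H <-; exact H. Qed.

Lemma exec_clear inp r v h o : exec inp (Loop r Skip) v h o (upd v r 0) h o.
Proof.
  remember (v r) as n eqn:E; revert v E; induction n as [|n IH]; intros v E.
  - apply (exec_eq _ _ _ _ _ v); [constructor; auto|upd_ext].
  - eapply exec_eq.
    + apply exec_loop_succ with n (upd v r n) h o; [auto|constructor|].
      apply IH; unfold upd; upd_tac.
    + upd_ext.
Qed.

Lemma exec_move inp a b v h o : a <> b ->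
  exec inp (Loop a (Inc b)) v h o (upd (upd v b (v b + v a)) a 0) h o.
Proof.
  intros Hab; remember (v a) as n eqn:E; revert v E.
  induction n as [|n IH]; intros v E.
  - apply (exec_eq _ _ _ _ _ v); [constructor; auto|upd_ext].
  - eapply exec_eq.
    + eapply exec_loop_succ with (n := n); [auto|constructor|].
      apply IH; unfold upd; upd_tac.
    + upd_ext.
Qed.

Lemma exec_copy inp a b c v h o : a <> b -> a <> c -> b <> c ->
  exec inp (Loop a (Seq (Inc b) (Inc c))) v h o
    (upd (upd (upd v b (v b + v a)) c (v c + v a)) a 0) h o.
Proof.
  intros Hab Hac Hbc; remember (v a) as n eqn:E; revert v E.
  induction n as [|n IH]; intros v E.
  - apply (exec_eq _ _ _ _ _ v); [constructor; auto|upd_ext].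
  - eapply exec_eq.
    + eapply exec_loop_succ with (n := n); [auto|repeat econstructor|].
      apply IH; unfold upd; upd_tac.
    + upd_ext.
Qed.

Lemma exec_seek_right inp a b v h o : a <> b ->
  exec inp (Loop a (Seq (Inc b) (Seek Right))) v h o
    (upd (upd v b (v b + v a)) a 0) (h + v a) o.
Proof.
  intros Hab; remember (v a) as n eqn:E; revert v h E.
  induction n as [|n IH]; intros v h E.
  - rewrite Nat.add_0_r, (Nat.add_0_r h).
    apply (exec_eq _ _ _ _ _ v); [constructor; auto|upd_ext].
  - eapply exec_eq.
    + eapply exec_loop_succ with (n := n); [auto|repeat econstructor|].
      rewrite <- Nat.add_succ_comm; apply IH; unfold upd; upd_tac.
    + upd_ext.
Qed.

Lemma exec_seek_left inp a v h o :
  exec inp (Loop a (Seek Left)) v (h + v a) o (upd v a 0) h o.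
Proof.
  remember (v a) as n eqn:E; revert v E.
  induction n as [|n IH]; intros v E.
  - rewrite Nat.add_0_r.
    apply (exec_eq _ _ _ _ _ v); [constructor; auto|upd_ext].
  - eapply exec_eq.
    + rewrite Nat.add_succ_r.
      eapply exec_loop_succ with (n := n); [auto|constructor|].
      apply IH; unfold upd; upd_tac.
    + upd_ext.
Qed.

Lemma scons_registers (G v : nat -> nat) (d : nat) :
  (fun i => v (scons d G i)) = scons (v d) (fun i => v (G i)).
Proof. apply functional_extensionality; intros [|i]; reflexivity. Qed.

Lemma upd_registers (G v : nat -> nat) (d n : nat) :
  (forall i, G i < d) -> (fun i => upd v d n (G i)) = (fun i => v (G i)).
Proof.
  intros HG; apply functional_extensionality; intros i; unfold upd.
  specialize (HG i); upd_tac.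
Qed.

(** The invariant is chosen to compose: all scratch registers are zero again and the input head is
    back on cell 0, so that subterms can run one after another. *)
Theorem compile_correct (inp : Z -> nat) (t : term) :
  (forall z, inp z = blank \/ inp z = stroke \/ inp z = comma) ->
  forall G d v o,
  (forall i, G i < d) -> (forall j, d <= j -> v j = 0) ->
  exec inp (compile t G d) v 0 o
    (upd v d (eval (fun n => inp (Z.of_nat n)) t (fun i => v (G i)))) 0 o.
Proof.
  intros Hinp; induction t; intros G d v o HG Hv; cbn [compile eval].
  - specialize (HG i).
    eapply exec_eq; [eapply exec_seq; [apply exec_copy|apply exec_move]|]; try lia.
    upd_ext; rewrite ?Hv by lia; lia.
  - apply (exec_eq _ _ _ _ _ v); [constructor|].
    upd_ext.
  - eapply exec_eq; [eapply exec_seq; [apply IHt|apply exec_inc]|]; auto.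
    upd_ext.
  - eapply exec_eq; [eapply exec_seq; [apply IHt1|eapply exec_seq; [apply IHt2|
      eapply exec_seq; [apply exec_clear|apply exec_move]]]|]; auto; try lia.
    + intros [|i]; cbn; [lia|specialize (HG i); lia].
    + intros j Hj; unfold upd; upd_tac.
    + rewrite scons_registers, (upd_registers G v d) by exact HG.
      replace (upd v d _ d) with (eval (fun n => inp (Z.of_nat n)) t1
        (fun i => v (G i))) by (unfold upd; upd_tac).
      upd_ext; rewrite ?Hv by lia; lia.
  - set (N := eval _ t3 _); set (z := eval _ t1 _).
    set (f := fun k x => _).
    set (F := nat_rect (fun _ => nat) z f).
    (* Invariant of the loop for [Rec]: [d] counts down, [1 + d] counts up and is the bound counter,
       [2 + d] holds the accumulator. *)
    assert (Hloop : forall m k w,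
      (forall j, j < d -> w j = v j) -> w d = m -> w (1 + d) = k ->
      w (2 + d) = F k -> (forall j, 3 + d <= j -> w j = 0) ->
      exec inp (Loop d (Seq (compile t2 (scons (2 + d) (scons (1 + d) G)) (3 + d))
                (Seq (Loop (2 + d) Skip)
                  (Seq (Loop (3 + d) (Inc (2 + d))) (Inc (1 + d)))))) w 0 o
       (upd (upd (upd w d 0) (1 + d) (k + m)) (2 + d) (F (k + m))) 0 o).
    { induction m as [|m IH]; intros k w H1 H2 H3 H4 H5.
      - apply (exec_eq _ _ _ _ _ w); [constructor; auto|].
        rewrite Nat.add_0_r; upd_ext.
      - assert (HG' : forall i, scons (2 + d) (scons (1 + d) G) i < 3 + d)
          by (intros [|[|i]]; cbn; [lia|lia|specialize (HG i); lia]).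
        assert (Hf : eval (fun n => inp (Z.of_nat n)) t2 (fun i =>
            upd w d m (scons (2 + d) (scons (1 + d) G) i)) = F (S k)).
        { rewrite !scons_registers, (upd_registers G w d) by exact HG.
          replace (fun i => w (G i)) with (fun i => v (G i))
            by (apply functional_extensionality; intros i; rewrite H1; auto).
          change (F (S k)) with (f k (F k)); unfold f.
          f_equal; f_equal; [unfold upd; upd_tac|f_equal; unfold upd; upd_tac]. }
        eapply exec_eq.
        + eapply exec_loop_succ; [exact H2| |].
          * eapply exec_seq; [apply IHt2; [exact HG'|]|].
            { intros j Hj; unfold upd; upd_tac. }
            rewrite Hf.
            eapply exec_seq; [apply exec_clear|].
            eapply exec_seq; [apply exec_move; lia|apply exec_inc].
          * apply (IH (S k)); [intros j Hj| | | |intros j Hj]; unfold upd; upd_tac.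
        + rewrite <- Nat.add_succ_comm; upd_ext.
          rewrite H5 by lia; reflexivity. }
    eapply exec_eq.
    + eapply exec_seq; [apply IHt3; auto|].
      eapply exec_seq; [apply IHt1|].
      { intros i; specialize (HG i); lia. }
      { intros j Hj; unfold upd; upd_tac. }
      rewrite (upd_registers G v d) by exact HG; fold z; fold N.
      eapply exec_seq; [apply (Hloop N 0)|eapply exec_seq; [apply exec_clear|
        apply exec_move; lia]].
      all: try intros j Hj; unfold upd; upd_tac.
    + cbn [Nat.add]; fold F; upd_ext; rewrite ?Hv by lia; lia.
  (* Register [S d] keeps the position for the way back, and the increments reproduce the codes 0, 1
     and 2 of blank, stroke and comma. *)
  - set (n := eval _ t _).
    assert (Hn : upd v d n d = n) by (unfold upd; upd_tac).
    assert (HS : upd v d n (S d) = 0) by (unfold upd; upd_tac).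
    set (w := upd (upd (upd v d n) (S d) n) d (inp (Z.of_nat n))).
    assert (Hw : w (S d) = n) by (unfold w, upd; upd_tac).
    eapply exec_eq.
    + eapply exec_seq; [apply IHt; auto|]; fold n.
      eapply exec_seq; [apply exec_seek_right; lia|].
      eapply exec_seq with (v' := w) (h' := n);
        [|rewrite <- Hw at 1; exact (exec_seek_left inp (S d) w 0 o)].
      rewrite Hn, HS; cbn [Nat.add].
      destruct (Hinp (Z.of_nat n)) as [E|[E|E]].
      * eapply exec_eq; [apply exec_case_blank; exact E|].
        unfold w; rewrite E; upd_ext.
      * eapply exec_eq; [apply exec_case_stroke; [exact E|apply exec_inc]|].
        unfold w; rewrite E; upd_ext.
      * eapply exec_eq; [apply exec_case_comma; [exact E|
          eapply exec_seq; apply exec_inc]|].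
        unfold w; rewrite E; upd_ext.
    + unfold w; upd_ext; rewrite Hv by lia; reflexivity.
Qed.

(** * Machines that iterate a function *)

Definition emitted (a : nat) : list nat :=
  match a with 1 => [stroke] | 2 => [comma] | _ => [] end.

(** Register 0 holds the current state of an iteration of [g], and register 1
    is reset to 1 unless the value of [e] is above 2. *)
Definition body (g e : term) : cmd :=
  Seq (compile e (fun _ => 0) 1)
  (Seq (If 1 (Inc 1) (If 1 (Seq (Emit stroke) (Inc 1))
         (If 1 (Seq (Emit comma) (Inc 1)) (Loop 1 Skip))))
  (Seq (compile g (fun _ => 0) 2) (Seq (Loop 0 Skip) (Loop 2 (Inc 0))))).

Definition program (g e : term) : cmd := Seq (Inc 1) (Loop 1 (body g e)).

(** State 0 enters the loader, the program takes the states from 1 to [size (program g e)], and the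
    state after these is its exit, where the machine halts for lack of a rule. *)
Definition loader (g e : term) : nat := 2 + size (program g e).

Definition base (g e : term) : machine :=
  assemble (program g e) 1 (1 + size (program g e)) ++
  [Rule (loader g e) 2 blank blank Left 1].

(** The start value [n] is hard-wired by a chain of [n] rules that write strokes to register 0.
    Machines for different [n] differ only in such rules, so their codes are primitive recursive in
    [n]; this replaces the s-m-n theorem. *)
Fixpoint load (s n : nat) (M : machine) : machine :=
  match n with
  | 0 => M
  | S n => Rule (S (s + n)) 2 blank stroke Right (s + n) :: load s n M
  end.

Definition iteration (g e : term) (n : nat) : machine :=
  Rule 0 2 blank blank Right (loader g e + n) :: load (loader g e) n (base g e).

Lemma load_in (s n : nat) (M : machine) (r : rule) :
  In r (load s n M) ->
  In r M \/ exists k, k < n /\ r = Rule (S (s + k)) 2 blank stroke Right (s + k).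
Proof.
  induction n as [|n IH]; cbn [load In]; [auto|].
  intros [<-|H].
  - right; exists n; auto.
  - destruct (IH H) as [H'|(k & Hk & E)]; [auto|right; exists k; auto].
Qed.

Lemma load_incl (s n : nat) (M : machine) : incl M (load s n M).
Proof. induction n; cbn [load]; [apply incl_refl|apply incl_tl; assumption]. Qed.

Lemma load_rule (s n k : nat) (M : machine) : k < n ->
  In (Rule (S (s + k)) 2 blank stroke Right (s + k)) (load s n M).
Proof.
  induction n as [|n IH]; intros Hk; [lia|cbn [load In]].
  destruct (Nat.eq_dec k n) as [->|]; [auto|right; apply IH; lia].
Qed.

Lemma halted_stays (M : machine) (c : config) (t : nat) :
  halted M c -> Nat.iter t (step M) c = c.
Proof.
  intros H; induction t as [|t IH]; [reflexivity|].
  rewrite Nat.iter_succ, IH; unfold step; rewrite H; reflexivity.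
Qed.

Section Iteration.
Variables (g e : term).

Lemma iteration_in (n : nat) (r : rule) : In r (iteration g e n) ->
  In r (assemble (program g e) 1 (1 + size (program g e))) \/
  source r = 0 /\ r = Rule 0 2 blank blank Right (loader g e + n) \/
  r = Rule (loader g e) 2 blank blank Left 1 \/
  exists k, k < n /\
    r = Rule (S (loader g e + k)) 2 blank stroke Right (loader g e + k).
Proof.
  intros [<-|H]; [auto|].
  apply load_in in H; destruct H as [H|H]; [|auto].
  unfold base in H; rewrite in_app_iff in H; destruct H as [H|[H|[]]]; auto.
Qed.

Lemma iteration_deterministic (n : nat) : deterministic (iteration g e n).
Proof.
  intros r r' H H' E.
  apply iteration_in in H, H'.
  destruct H as [H|[[_ H]|[H|(k & Hk & H)]]],
    H' as [H'|[[_ H']|[H'|(k' & Hk' & H')]]];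
    [apply (assemble_deterministic _ _ _ r r' H H' E)|..];
    repeat match goal with
    | H : In _ (assemble _ _ _) |- _ => apply assemble_source in H
    end; subst; unfold loader in *; cbn [source] in *; try lia;
    split; intros; try reflexivity.
  assert (k = k') by lia; subst; reflexivity.
Qed.

Lemma iteration_one_way (n : nat) : one_way (iteration g e n).
Proof.
  intros r H Ht; apply iteration_in in H.
  destruct H as [H|[[_ H]|[H|(k & Hk & H)]]]; try (subst; discriminate).
  apply (assemble_one_way _ _ _ r H Ht).
Qed.

Lemma iteration_incl (n : nat) :
  incl (assemble (program g e) 1 (1 + size (program g e))) (iteration g e n).
Proof.
  intros r H; right; apply load_incl; unfold base; apply in_or_app; auto.
Qed.

Definition registers (s f : nat) : nat -> nat :=
  fun r => match r with 0 => s | 1 => f | _ => 0 end.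

Variable inp : Z -> nat.
Hypothesis inp_symbol : forall z, inp z = blank \/ inp z = stroke \/ inp z = comma.

Let G (s : nat) : nat := eval (fun n => inp (Z.of_nat n)) g (fun _ => s).
Let E (s : nat) : nat := eval (fun n => inp (Z.of_nat n)) e (fun _ => s).

Lemma body_correct (s : nat) (o : list nat) :
  exec inp (body g e) (registers s 0) 0 o
    (registers (G s) (if E s <=? 2 then 1 else 0)) 0 (o ++ emitted (E s)).
Proof.
  set (f := if E s <=? 2 then 1 else 0).
  eapply exec_seq.
  { apply compile_correct; auto. intros [|[|j]] Hj; cbn; lia. }
  eapply exec_seq with (v' := registers s f) (h' := 0) (o' := o ++ emitted (E s)).
  { change (eval _ e _) with (E s); unfold f, emitted; clear.
    destruct (E s) as [|[|[|n]]]; cbn [Nat.leb]; cbn iota; rewrite ?app_nil_r.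
    - apply exec_if_zero; [reflexivity|].
      eapply exec_eq; [constructor|]; upd_ext. destruct j as [|[|]]; cbn; lia.
    - eapply exec_if_succ; [reflexivity|]; apply exec_if_zero; [reflexivity|].
      eapply exec_eq; [eapply exec_seq; [apply exec_emit|apply exec_inc]|].
      upd_ext; destruct j as [|[|]]; cbn; lia.
    - eapply exec_if_succ; [reflexivity|]; eapply exec_if_succ; [reflexivity|].
      apply exec_if_zero; [reflexivity|].
      eapply exec_eq; [eapply exec_seq; [apply exec_emit|apply exec_inc]|].
      upd_ext; destruct j as [|[|]]; cbn; lia.
    - eapply exec_if_succ; [reflexivity|]; eapply exec_if_succ; [reflexivity|].
      eapply exec_if_succ; [reflexivity|].
      eapply exec_eq; [apply exec_clear|].
      upd_ext; destruct j as [|[|]]; cbn; lia. }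
  eapply exec_eq.
  - eapply exec_seq; [apply compile_correct; auto; intros [|[|j]] Hj; cbn; lia|].
    eapply exec_seq; [apply exec_clear|apply exec_move; lia].
  - change (eval _ g _) with (G s).
    upd_ext; destruct j as [|[|[|]]]; cbn; lia.
Qed.

Lemma loaded (n : nat) :
  represents inp (run (iteration g e n) inp (2 + n)) 1 (registers n 0) 0 [].
Proof.
  set (M := iteration g e n); set (d := loader g e).
  assert (HM := iteration_deterministic n : deterministic M).
  assert (Hk : forall k, k <= n ->
    let c := run M inp (S k) in
    state c = d + (n - k) /\
    (forall j, head c j = if j =? 2 then Z.of_nat (S k) else 0%Z) /\
    (forall j z, cell c j z = if j =? 0 then inp z else
       if (j =? 2) && (0 <? z)%Z && (z <? Z.of_nat (S k))%Z then stroke else blank)).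
  { induction k as [|k IH]; intros Hk; cbv zeta.
    - change (run M inp 1) with (step M (initial inp)).
      rewrite (step_rule M (initial inp) (Rule 0 2 blank blank Right (d + n)) HM);
        [|left; reflexivity|reflexivity|reflexivity].
      split; [cbn; lia|split].
      + intros j; cbn_execute; cbn; cell_cases; lia.
      + intros j z; unfold initial; cbn_execute; cell_cases; auto; try lia.
        destruct (Z.ltb_spec 0 z), (Z.ltb_spec z (Z.of_nat 1)); cbn; auto; lia.
    - destruct (IH ltac:(lia)) as (H1 & H2 & H3); clear IH.
      change (run M inp (S (S k))) with (step M (run M inp (S k))).
      set (c := run M inp (S k)) in *; clearbody c.
      rewrite (step_rule M c
        (Rule (S (d + (n - S k))) 2 blank stroke Right (d + (n - S k))) HM);
        [|right; apply load_rule; lia|cbn_execute; rewrite H1; lia|].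
      2:{ cbn_execute; rewrite H2, H3; cbn [Nat.eqb andb].
          rewrite Z.ltb_irrefl, andb_false_r; reflexivity. }
      split; [cbn_execute; lia|split].
      + intros j; cbn_execute; rewrite H2; cell_cases; lia.
      + intros j z; cbn_execute; rewrite H2, H3; cell_cases; auto; try lia.
        * destruct (Z.ltb_spec 0 (Z.of_nat (S k))),
            (Z.ltb_spec (Z.of_nat (S k)) (Z.of_nat (S (S k)))); cbn; auto; lia.
        * destruct (Z.ltb_spec 0 z), (Z.ltb_spec z (Z.of_nat (S (S k)))),
            (Z.ltb_spec z (Z.of_nat (S k))); cbn; auto; lia. }
  destruct (Hk n (le_n n)) as (H1 & H2 & H3); clear Hk.
  change (run M inp (2 + n)) with (step M (run M inp (S n))).
  set (c := run M inp (S n)) in *; clearbody c.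
  rewrite (step_rule M c (Rule d 2 blank blank Left 1) HM);
    [|right; apply load_incl, in_or_app; right; left; reflexivity
     |cbn_execute; rewrite H1; lia|].
  2:{ cbn_execute; rewrite H2, H3; cbn [Nat.eqb andb].
      rewrite Z.ltb_irrefl, andb_false_r; reflexivity. }
  assert (H4 : forall j z, cell (execute (Rule d 2 blank blank Left 1) c) j z =
    cell c j z).
  { intros j z; cbn_execute; cell_cases; auto.
    rewrite H2, H3; cbn [Nat.eqb andb].
    rewrite Z.ltb_irrefl, andb_false_r; reflexivity. }
  split; intros; rewrite ?H4, ?H3; cbn_execute; rewrite ?H2; auto.
  - destruct m; reflexivity.
  - destruct j as [|[|j]]; cbn [Nat.eqb registers]; lia.
  - rewrite andb_false_r; reflexivity.
  - destruct j as [|[|j]]; cbn [registers] in H; try lia.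
    destruct (Z.ltb_spec 0 z), (Z.ltb_spec z (Z.of_nat (S n))); cbn; auto; lia.
  - destruct (_ && _); auto.
Qed.

Variable n : nat.
Let S_ (j : nat) : nat := Nat.iter j G n.
Let O_ (j : nat) : list nat := flat_map (fun i => emitted (E (S_ i))) (seq 0 j).

(** [Inc 1] takes the states 1 and 2, so state 3 is the test of the main loop and state 4 the entry
    of its body. The bound [j <= t] yields a loop test later than any alleged halting time. *)
Lemma loop_reached (j : nat) : (forall i, i < j -> E (S_ i) <= 2) ->
  exists t, j <= t /\
    represents inp (run (iteration g e n) inp t) 3 (registers (S_ j) 1) 0 (O_ j).
Proof.
  set (M := iteration g e n).
  assert (HM := iteration_deterministic n : deterministic M).
  assert (Hi := iteration_incl n); cbn [program assemble] in Hi.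
  apply incl_app_inv in Hi; destruct Hi as [Hi1 Hi2].
  induction j as [|j IH]; intros HE.
  - exists (2 + (2 + n)); split; [lia|].
    unfold run; rewrite Nat.iter_add.
    assert (H := step_increment inp M HM _ _ 2 _ _ _ 1 3 (loaded n) Hi1).
    replace (registers (S_ 0) 1) with (upd (registers n 0) 1 (S (registers n 0 1)));
      [exact H|].
    upd_ext; destruct j as [|[|]]; cbn; auto; lia.
  - destruct IH as (t & Ht & Hr); [auto|].
    eapply step_decrement with (r := 1) (n := 0) (x := 4) in Hr;
      [|exact HM|reflexivity|apply Hi2; right; left; reflexivity].
    assert (Hb := body_correct (S_ j) (O_ j)).
    rewrite (proj2 (Nat.leb_le (E (S_ j)) 2)) in Hb by auto.
    destruct (assemble_correct inp M inp_symbol HM _ _ _ _ _ _ _ Hb 4 3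
      (step M (run M inp t))) as [t' Ht'].
    + intros r H; apply Hi2; apply in_or_app; right; exact H.
    + replace (registers (S_ j) 0) with (upd (registers (S_ j) 1) 1 0); [exact Hr|].
      upd_ext; destruct j0 as [|[|]]; cbn; auto; lia.
    + exists (t' + S t); split; [lia|].
      unfold run; rewrite Nat.iter_add.
      change (S_ (S j)) with (G (S_ j)).
      replace (O_ (S j)) with (O_ j ++ emitted (E (S_ j))); [exact Ht'|].
      unfold O_; rewrite seq_S, flat_map_app; cbn; rewrite app_nil_r; reflexivity.
Qed.

Theorem iteration_halts : halts (iteration g e n) inp <-> exists j, 2 < E (S_ j).
Proof.
  set (M := iteration g e n).
  assert (HM := iteration_deterministic n : deterministic M).
  assert (Hi := iteration_incl n); cbn [program assemble] in Hi.
  apply incl_app_inv in Hi; destruct Hi as [Hi1 Hi2].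
  split.
  - intros [t Ht].
    destruct (classic (exists j, 2 < E (S_ j))) as [H|H]; [exact H|exfalso].
    destruct (loop_reached t) as (t' & Hle & Hr).
    { intros i _; destruct (le_lt_dec (E (S_ i)) 2); [auto|exfalso; eauto]. }
    fold M in Hr; replace t' with ((t' - t) + t) in Hr by lia.
    unfold run in Hr, Ht; rewrite Nat.iter_add, halted_stays in Hr by exact Ht.
    (* At the loop test register 1 holds 1, so this rule applies to a configuration that was assumed
       to be halted. *)
    assert (Ha : In (Rule 3 3 stroke stroke Left 4) M)
      by (apply Hi2; right; left; reflexivity).
    apply (find_none _ _ Ht) in Ha; unfold applicable in Ha; cbn_execute.
    assert (H1 := rep_head _ _ _ _ _ _ Hr 1).
    assert (H2 := rep_below _ _ _ _ _ _ Hr 1 (Z.of_nat 1) ltac:(cbn; lia)).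
    cbn_execute; rewrite (rep_state _ _ _ _ _ _ Hr), H1 in Ha.
    cbn [registers] in Ha; rewrite H2 in Ha; discriminate.
  - intros H.
    destruct (dec_inh_nat_subset_has_unique_least_element (fun j => 2 < E (S_ j)))
      as (j & [Hj Hleast] & _); [intros; lia|exact H|].
    destruct (loop_reached j) as (t & _ & Hr).
    { intros i Hi; destruct (le_lt_dec (E (S_ i)) 2) as [|Hl]; [auto|].
      specialize (Hleast _ Hl); lia. }
    eapply step_decrement with (r := 1) (n := 0) (x := 4) in Hr;
      [|exact HM|reflexivity|apply Hi2; right; left; reflexivity].
    assert (Hb := body_correct (S_ j) (O_ j)).
    rewrite (proj2 (Nat.leb_gt (E (S_ j)) 2)) in Hb by auto.
    destruct (assemble_correct inp M inp_symbol HM _ _ _ _ _ _ _ Hb 4 3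
      (step M (run M inp t))) as [t' Ht'].
    + intros r H'; apply Hi2; apply in_or_app; right; exact H'.
    + replace (registers (S_ j) 0) with (upd (registers (S_ j) 1) 1 0); [exact Hr|].
      upd_ext; destruct j0 as [|[|]]; cbn; auto; lia.
    + eapply step_zero with (r := 1) in Ht';
        [|exact HM|reflexivity|apply Hi2; left; reflexivity].
      exists (S (t' + S t)); unfold run; rewrite Nat.iter_succ, Nat.iter_add.
      (* The loop exits into the state [1 + size (program g e)], which is the source of no rule. *)
      unfold halted; destruct (find _ _) as [r|] eqn:F; [|reflexivity].
      apply find_some in F; destruct F as [Hr' Ha].
      unfold applicable in Ha; apply andb_true_iff in Ha; destruct Ha as [Ha _].
      apply Nat.eqb_eq in Ha.
      assert (Hs := rep_state _ _ _ _ _ _ Ht').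
      change (step M (run M inp t)) with (Nat.iter (S t) (step M) (initial inp)) in Hs.
      rewrite Hs in Ha.
      apply iteration_in in Hr'.
      destruct Hr' as [H'|[[H' _]|[H'|(k & Hk & H')]]];
        [apply assemble_source in H'|..]; subst; unfold loader in *;
        cbn [program size source] in *; lia.
Qed.

Theorem iteration_output (m j : nat) :
  (forall i, E (S_ i) <= 2) -> m < length (O_ j) ->
  exists t0, forall t, t0 <= t ->
    cell (run (iteration g e n) inp t) output_tape (Z.of_nat m) = nth m (O_ j) blank.
Proof.
  intros HE Hm; destruct (loop_reached j) as (t0 & _ & Hr); [auto|].
  exists t0; intros t Ht; replace t with ((t - t0) + t0) by lia.
  unfold run; rewrite Nat.iter_add.
  destruct (one_way_final _ (run (iteration g e n) inp t0) (Z.of_nat m) (t - t0)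
    (iteration_one_way n)) as [_ H].
  { rewrite (rep_output_head _ _ _ _ _ _ Hr); apply inj_lt, Hm. }
  unfold run in H; rewrite H; apply (rep_output _ _ _ _ _ _ Hr).
Qed.
End Iteration.

(** * Definability *)

Definition lift (r : nat -> nat) : nat -> nat := scons 0 (fun i => S (r i)).

Fixpoint rename (r : nat -> nat) (t : term) : term :=
  match t with
  | Var i => Var (r i)
  | Zero => Zero
  | Succ t => Succ (rename r t)
  | Let a b => Let (rename r a) (rename (lift r) b)
  | Rec z s n => Rec (rename r z) (rename (lift (lift r)) s) (rename r n)
  | Sym t => Sym (rename r t)
  end.

Lemma scons_lift (r v : nat -> nat) (a : nat) :
  (fun i => scons a v (lift r i)) = scons a (fun i => v (r i)).
Proof. apply functional_extensionality; intros [|i]; reflexivity. Qed.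

Lemma eval_rename (inp : nat -> nat) (t : term) : forall r v,
  eval inp (rename r t) v = eval inp t (fun i => v (r i)).
Proof.
  induction t; intros r v; cbn [rename eval]; rewrite ?IHt, ?IHt1, ?IHt2, ?IHt3; auto.
  - rewrite scons_lift; reflexivity.
  - f_equal; apply functional_extensionality; intros k.
    apply functional_extensionality; intros x; rewrite IHt2, !scons_lift; reflexivity.
Qed.

(** [pr f] says that [f inp v] is primitive recursive in the variables [v],
    relative to the input word [inp]. *)
Definition pr (f : (nat -> nat) -> (nat -> nat) -> nat) : Prop :=
  exists t, forall inp v, eval inp t v = f inp v.

Definition prb (f : (nat -> nat) -> (nat -> nat) -> bool) : Prop :=
  pr (fun o v => Nat.b2n (f o v)).

Lemma pr_ext f f' : pr f -> (forall o v, f o v = f' o v) -> pr f'.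
Proof. intros [t Ht] H; exists t; intros; rewrite Ht; auto. Qed.

Lemma prb_ext f f' : prb f -> (forall o v, f o v = f' o v) -> prb f'.
Proof. intros Hf H; apply (pr_ext _ _ Hf); intros; rewrite H; auto. Qed.

Lemma pr_var i : pr (fun _ v => v i).
Proof. exists (Var i); reflexivity. Qed.

Lemma pr_const n : pr (fun _ _ => n).
Proof.
  induction n as [|n [t Ht]]; [exists Zero; reflexivity|exists (Succ t)].
  intros; cbn [eval]; rewrite Ht; reflexivity.
Qed.

Lemma pr_S a : pr a -> pr (fun o v => S (a o v)).
Proof. intros [t Ht]; exists (Succ t); intros; cbn [eval]; rewrite Ht; auto. Qed.

Lemma pr_sym a : pr a -> pr (fun o v => o (a o v)).
Proof. intros [t Ht]; exists (Sym t); intros; cbn [eval]; rewrite Ht; auto. Qed.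

Lemma pr_rename a r : pr a -> pr (fun o v => a o (fun i => v (r i))).
Proof.
  intros [t Ht]; exists (rename r t); intros; rewrite eval_rename; apply Ht.
Qed.

Lemma pr_let a b : pr a -> pr b -> pr (fun o v => b o (scons (a o v) v)).
Proof.
  intros [t Ht] [u Hu]; exists (Let t u); intros; cbn [eval]; rewrite Hu, Ht; auto.
Qed.

Lemma pr_rec z s n : pr z -> pr n ->
  pr (fun o v => s o (fun i => v (S (S i))) (v 1) (v 0)) ->
  pr (fun o v => nat_rect (fun _ => nat) (z o v) (s o v) (n o v)).
Proof.
  intros [z' Hz] [n' Hn] [s' Hs]; exists (Rec z' s' n'); intros; cbn [eval].
  rewrite Hz, Hn; f_equal.
  apply functional_extensionality; intros k; apply functional_extensionality; intros x.
  rewrite Hs; reflexivity.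
Qed.

Lemma pr_iter f n a : pr n -> pr a ->
  pr (fun o v => f o (fun i => v (S i)) (v 0)) ->
  pr (fun o v => Nat.iter (n o v) (f o v) (a o v)).
Proof.
  intros Hn Ha Hf; apply (pr_rec a (fun o v _ => f o v)); auto.
  apply (pr_rename _ (fun i => match i with 0 => 0 | S i => S (S i) end) Hf).
Qed.

Lemma pr_comp1 f a : pr (fun o v => f o (v 0)) -> pr a -> pr (fun o v => f o (a o v)).
Proof. intros Hf Ha; apply (pr_let _ _ Ha Hf). Qed.

Lemma pr_comp2 f a b : pr (fun o v => f o (v 0) (v 1)) -> pr a -> pr b ->
  pr (fun o v => f o (a o v) (b o v)).
Proof.
  intros Hf Ha Hb.
  apply (pr_let _ _ Hb (pr_let _ _ (pr_rename _ S Ha) Hf)).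
Qed.

Lemma pr_comp4 f a b c d : pr (fun o v => f o (v 0) (v 1) (v 2) (v 3)) ->
  pr a -> pr b -> pr c -> pr d ->
  pr (fun o v => f o (a o v) (b o v) (c o v) (d o v)).
Proof.
  intros Hf Ha Hb Hc Hd.
  apply (pr_let _ _ Hd (pr_let _ _ (pr_rename _ S Hc)
    (pr_let _ _ (pr_rename _ (fun i => S (S i)) Hb)
    (pr_let _ _ (pr_rename _ (fun i => S (S (S i))) Ha) Hf)))).
Qed.

Create HintDb pr discriminated.

Ltac pr := auto 100 with pr.

#[export] Hint Extern 0 (pr (fun _ v => v _)) => apply pr_var : pr.
#[export] Hint Extern 0 (pr (fun _ _ => ?n)) => apply (pr_const n) : pr.
#[export] Hint Resolve pr_S : pr.

Lemma pr_add a b : pr a -> pr b -> pr (fun o v => a o v + b o v).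
Proof.
  apply (pr_comp2 (fun _ => Nat.add)).
  apply (pr_ext (fun _ v => Nat.iter (v 0) S (v 1))).
  - apply (pr_iter (fun _ _ => S)); auto with pr.
  - intros _ v; induction (v 0); cbn; auto.
Qed.
#[export] Hint Resolve pr_add : pr.

Lemma pr_b2n b : prb b -> pr (fun o v => Nat.b2n (b o v)).
Proof. intros H; exact H. Qed.
#[export] Hint Resolve pr_b2n : pr.

Lemma pr_mul a b : pr a -> pr b -> pr (fun o v => a o v * b o v).
Proof.
  apply (pr_comp2 (fun _ => Nat.mul)).
  apply (pr_ext (fun _ v => Nat.iter (v 0) (fun x => v 1 + x) 0)).
  - apply (pr_iter (fun _ v x => v 1 + x)); pr.
  - intros _ v; induction (v 0); cbn; auto.
Qed.
#[export] Hint Resolve pr_mul : pr.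

Lemma pr_pow a b : pr a -> pr b -> pr (fun o v => a o v ^ b o v).
Proof.
  apply (pr_comp2 (fun _ => Nat.pow)).
  apply (pr_ext (fun _ v => Nat.iter (v 1) (fun x => v 0 * x) 1)).
  - apply (pr_iter (fun _ v x => v 0 * x)); pr.
  - intros _ v; induction (v 1); cbn; auto.
Qed.
#[export] Hint Resolve pr_pow : pr.

Lemma pr_pred a : pr a -> pr (fun o v => pred (a o v)).
Proof.
  apply (pr_comp1 (fun _ => pred)).
  apply (pr_ext (fun _ v => nat_rect (fun _ => nat) 0 (fun k _ => k) (v 0))).
  - apply (pr_rec (fun _ _ => 0) (fun _ _ k _ => k)); pr.
  - intros _ v; destruct (v 0); reflexivity.
Qed.
#[export] Hint Resolve pr_pred : pr.

Lemma pr_sub a b : pr a -> pr b -> pr (fun o v => a o v - b o v).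
Proof.
  apply (pr_comp2 (fun _ => Nat.sub)).
  apply (pr_ext (fun _ v => Nat.iter (v 1) pred (v 0))).
  - apply (pr_iter (fun _ _ => pred)); pr.
  - intros _ v; induction (v 1); [cbn; lia|rewrite Nat.iter_succ; lia].
Qed.
#[export] Hint Resolve pr_sub : pr.

Lemma pr_if c a b : prb c -> pr a -> pr b ->
  pr (fun o v => if c o v then a o v else b o v).
Proof.
  intros Hc Ha Hb.
  apply (pr_ext (fun o v => Nat.b2n (c o v) * a o v + (1 - Nat.b2n (c o v)) * b o v));
    [pr|].
  intros o v; destruct (c o v); cbn; lia.
Qed.
#[export] Hint Resolve pr_if : pr.

Lemma prb_const b : prb (fun _ _ => b).
Proof. apply (pr_const (Nat.b2n b)). Qed.
#[export] Hint Extern 0 (prb (fun _ _ => ?b)) => apply (prb_const b) : pr.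

Lemma prb_and a b : prb a -> prb b -> prb (fun o v => a o v && b o v).
Proof.
  intros Ha Hb; apply (pr_ext (fun o v => Nat.b2n (a o v) * Nat.b2n (b o v))); [pr|].
  intros o v; destruct (a o v), (b o v); reflexivity.
Qed.

Lemma prb_not a : prb a -> prb (fun o v => negb (a o v)).
Proof.
  intros Ha; apply (pr_ext (fun o v => 1 - Nat.b2n (a o v))); [pr|].
  intros o v; destruct (a o v); reflexivity.
Qed.
#[export] Hint Resolve prb_and prb_not : pr.

Lemma prb_or a b : prb a -> prb b -> prb (fun o v => a o v || b o v).
Proof.
  intros Ha Hb; apply (prb_ext (fun o v => negb (negb (a o v) && negb (b o v)))); [pr|].
  intros o v; destruct (a o v), (b o v); reflexivity.
Qed.
#[export] Hint Resolve prb_or : pr.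

Lemma prb_leb a b : pr a -> pr b -> prb (fun o v => a o v <=? b o v).
Proof.
  intros Ha Hb; apply (pr_ext (fun o v => 1 - (a o v - b o v))); [pr|].
  intros o v; destruct (Nat.leb_spec (a o v) (b o v)); cbn [Nat.b2n]; lia.
Qed.
#[export] Hint Resolve prb_leb : pr.

Lemma prb_ltb a b : pr a -> pr b -> prb (fun o v => a o v <? b o v).
Proof. intros Ha Hb; apply (prb_leb (fun o v => S (a o v))); pr. Qed.

Lemma prb_eqb a b : pr a -> pr b -> prb (fun o v => a o v =? b o v).
Proof.
  intros Ha Hb.
  apply (prb_ext (fun o v => (a o v <=? b o v) && (b o v <=? a o v))); [pr|].
  intros o v; destruct (Nat.leb_spec (a o v) (b o v)), (Nat.leb_spec (b o v) (a o v)),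
    (Nat.eqb_spec (a o v) (b o v)); cbn; auto; lia.
Qed.
#[export] Hint Resolve prb_ltb prb_eqb : pr.

(** * Bounded quantifiers and bounded search *)

Fixpoint bexists (n : nat) (P : nat -> bool) : bool :=
  match n with 0 => false | S n => P n || bexists n P end.

Definition bforall (n : nat) (P : nat -> bool) : bool :=
  negb (bexists n (fun k => negb (P k))).

Lemma bexists_iff n P : bexists n P = true <-> exists k, k < n /\ P k = true.
Proof.
  induction n as [|n IH]; cbn [bexists].
  - split; [discriminate|intros (k & Hk & _); lia].
  - rewrite orb_true_iff, IH; split.
    + intros [H|(k & Hk & H)]; eauto.
    + intros (k & Hk & H); destruct (Nat.eq_dec k n) as [->|]; [auto|].
      right; exists k; split; [lia|auto].
Qed.

Lemma bforall_iff n P : bforall n P = true <-> forall k, k < n -> P k = true.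
Proof.
  unfold bforall; rewrite negb_true_iff, <- not_true_iff_false, bexists_iff; split.
  - intros H k Hk; destruct (P k) eqn:E; [auto|].
    destruct H; exists k; rewrite E; auto.
  - intros H (k & Hk & E); rewrite H in E by auto; discriminate.
Qed.

Lemma prb_exists P n : pr n -> prb (fun o v => P o (fun i => v (S i)) (v 0)) ->
  prb (fun o v => bexists (n o v) (P o v)).
Proof.
  intros Hn HP.
  apply (pr_ext (fun o v => nat_rect (fun _ => nat) 0
    (fun k x => Nat.b2n (P o v k || (x =? 1))) (n o v))).
  - apply (pr_rec (fun _ _ => 0) (fun o v k x => Nat.b2n (P o v k || (x =? 1))));
      [pr|pr|].
    apply pr_b2n, prb_or; [|pr].
    exact (pr_rename _ S HP).
  - intros o v; induction (n o v) as [|m IH]; [reflexivity|cbn [nat_rect bexists]].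
    rewrite IH; destruct (P o v m), (bexists m (P o v)); reflexivity.
Qed.

Lemma prb_forall P n : pr n -> prb (fun o v => P o (fun i => v (S i)) (v 0)) ->
  prb (fun o v => bforall (n o v) (P o v)).
Proof.
  intros Hn HP; apply prb_not.
  apply (prb_exists (fun o v k => negb (P o v k))); [|apply prb_not]; auto.
Qed.

(** The least [k < n] with [P k], or [n] if there is none. *)
Definition search (n : nat) (P : nat -> bool) : nat :=
  Nat.iter n (fun x => if P x then x else S x) 0.

Lemma search_spec n P : search n P <= n /\
  (forall k, k < search n P -> P k = false) /\
  (search n P < n -> P (search n P) = true).
Proof.
  induction n as [|n (H1 & H2 & H3)]; [cbn; split; [lia|split; lia]|].
  unfold search in *; rewrite Nat.iter_succ; set (x := Nat.iter n _ 0) in *.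
  clearbody x; destruct (P x) eqn:E; split; [lia|split; auto|lia|split].
  - intros k Hk; destruct (Nat.eq_dec k x) as [->|]; [auto|apply H2; lia].
  - intros Hx; discriminate H3; lia.
Qed.

Lemma pr_search P n : pr n -> prb (fun o v => P o (fun i => v (S i)) (v 0)) ->
  pr (fun o v => search (n o v) (P o v)).
Proof.
  intros Hn HP; apply (pr_iter (fun o v x => if P o v x then x else S x)); pr.
Qed.

(** * Cantor pairing and finite words *)

Definition pair (a b : nat) : nat := to_nat (a, b).
Definition p1 (n : nat) : nat := fst (of_nat n).
Definition p2 (n : nat) : nat := snd (of_nat n).
Arguments pair : simpl never.
Arguments p1 : simpl never.
Arguments p2 : simpl never.

Lemma p1_pair a b : p1 (pair a b) = a.
Proof. unfold p1, pair; rewrite cancel_of_to; reflexivity. Qed.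

Lemma p2_pair a b : p2 (pair a b) = b.
Proof. unfold p2, pair; rewrite cancel_of_to; reflexivity. Qed.

Lemma pair_p n : pair (p1 n) (p2 n) = n.
Proof. unfold p1, p2, pair; rewrite <- surjective_pairing; apply cancel_to_of. Qed.

Lemma p1_le n : p1 n <= n.
Proof.
  rewrite <- (pair_p n) at 2; assert (H := to_nat_non_decreasing (p1 n) (p2 n)).
  unfold pair; lia.
Qed.

Lemma p2_le n : p2 n <= n.
Proof.
  rewrite <- (pair_p n) at 2; assert (H := to_nat_non_decreasing (p1 n) (p2 n)).
  unfold pair; lia.
Qed.

Lemma pr_pair a b : pr a -> pr b -> pr (fun o v => pair (a o v) (b o v)).
Proof.
  apply (pr_comp2 (fun _ => pair)).
  apply (pr_ext (fun _ v => v 1 + nat_rect (fun _ => nat) 0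
    (fun i m => S i + m) (v 1 + v 0))).
  - apply pr_add; [pr|].
    apply (pr_rec (fun _ _ => 0) (fun _ _ i m => S i + m)); pr.
  (* [to_nat (x, y)] is by definition [y] plus the triangular number of [y + x]. *)
  - reflexivity.
Qed.
#[export] Hint Resolve pr_pair : pr.

(** The components of [n] are found by search below [n]; the case [p1 n = n], as for [n = 0], is
    covered by the default value [n] of [search]. *)
Lemma pr_p1 a : pr a -> pr (fun o v => p1 (a o v)).
Proof.
  apply (pr_comp1 (fun _ => p1)).
  apply (pr_ext (fun _ v => search (v 0) (fun x => bexists (S (v 0))
    (fun y => pair x y =? v 0)))).
  - apply (pr_search (fun _ v x => bexists (S (v 0)) (fun y => pair x y =? v 0))); [pr|].
    apply (prb_exists (fun _ v y => pair (v 0) y =? v 1)); pr.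
  - intros _ v; generalize (v 0); clear v; intros n.
    match goal with |- search n ?P = _ =>
      destruct (search_spec n P) as (H1 & H2 & H3) end.
    set (x := search n _) in *; clearbody x.
    destruct (lt_eq_lt_dec x (p1 n)) as [[H|H]|H]; [|exact H|].
    + assert (Hp := p1_le n); specialize (H3 ltac:(lia)); rewrite bexists_iff in H3.
      destruct H3 as (y & _ & E); apply Nat.eqb_eq in E.
      subst n; rewrite p1_pair in H; lia.
    + specialize (H2 _ H); rewrite <- not_true_iff_false, bexists_iff in H2.
      destruct H2; exists (p2 n); split; [assert (Hp := p2_le n); lia|].
      rewrite pair_p; apply Nat.eqb_refl.
Qed.
#[export] Hint Resolve pr_p1 : pr.

Lemma pr_p2 a : pr a -> pr (fun o v => p2 (a o v)).
Proof.
  apply (pr_comp1 (fun _ => p2)).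
  apply (pr_ext (fun _ v => search (v 0) (fun y => pair (p1 (v 0)) y =? v 0))).
  - apply (pr_search (fun _ v y => pair (p1 (v 0)) y =? v 0)); pr.
  - intros _ v; generalize (v 0); clear v; intros n.
    match goal with |- search n ?P = _ =>
      destruct (search_spec n P) as (H1 & H2 & H3) end.
    set (x := search n _) in *; clearbody x.
    destruct (lt_eq_lt_dec x (p2 n)) as [[H|H]|H]; [|exact H|].
    + assert (Hp := p2_le n); specialize (H3 ltac:(lia)).
      apply Nat.eqb_eq in H3; rewrite <- H3, p2_pair in H; lia.
    + specialize (H2 _ H); rewrite pair_p, Nat.eqb_refl in H2; discriminate.
Qed.
#[export] Hint Resolve pr_p2 : pr.

(** Every number codes a finite word, of length [len w] and with letters
    [get w i]. *)
Definition len (w : nat) : nat := p1 w.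
Definition get (w i : nat) : nat := p1 (Nat.iter i p2 (p2 w)).

Lemma pr_len a : pr a -> pr (fun o v => len (a o v)).
Proof. intros H; unfold len; pr. Qed.

Lemma pr_get a b : pr a -> pr b -> pr (fun o v => get (a o v) (b o v)).
Proof.
  apply (pr_comp2 (fun _ => get)); unfold get.
  apply pr_p1, (pr_iter (fun _ _ => p2)); pr.
Qed.
#[export] Hint Resolve pr_len pr_get : pr.

Lemma word_exists (f : nat -> nat) (n : nat) :
  exists w, len w = n /\ forall i, i < n -> get w i = f i.
Proof.
  assert (exists u, forall i, i < n -> p1 (Nat.iter i p2 u) = f i) as [u Hu].
  { revert f; induction n as [|n IH]; intros f; [exists 0; lia|].
    destruct (IH (fun i => f (S i))) as [u Hu].
    exists (pair (f 0) u); intros [|i] Hi; [apply p1_pair|].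
    rewrite Nat.iter_succ_r, p2_pair; apply Hu; lia. }
  exists (pair n u); unfold len, get; rewrite p1_pair, p2_pair; auto.
Qed.

(** * Simulation of a machine *)

(** Finite memories, as association lists with default value 0. *)
Definition put (k x m : nat) : nat := S (pair (pair k x) m).

Definition scan (k c : nat) : nat :=
  if (c =? 0) || (p1 (p1 (pred c)) =? k) then c else p2 (pred c).

Definition look (m k : nat) : nat :=
  let c := Nat.iter m (scan k) m in if c =? 0 then 0 else p2 (p1 (pred c)).

Lemma scan_le k c : scan k c <= c.
Proof.
  unfold scan; destruct (_ || _); [lia|]; assert (H := p2_le (pred c)); lia.
Qed.

(** [look] takes the memory itself as the number of iterations. As [scan] strictly decreases until
    it is stationary, every larger number gives the same result. *)
Lemma scan_fixed k m : forall n, m <= n ->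
  Nat.iter n (scan k) m = Nat.iter m (scan k) m.
Proof.
  induction m as [m IH] using lt_wf_ind; intros n Hn.
  destruct (Nat.eq_dec (scan k m) m) as [E|E].
  - assert (H : forall j, Nat.iter j (scan k) m = m).
    { induction j as [|j IHj]; [reflexivity|rewrite Nat.iter_succ, IHj; exact E]. }
    rewrite !H; reflexivity.
  - assert (Hl := scan_le k m).
    destruct n as [|n], m as [|m]; try lia.
    rewrite !Nat.iter_succ_r.
    rewrite (IH (scan k (S m)) ltac:(lia) n) by lia.
    rewrite (IH (scan k (S m)) ltac:(lia) m) by lia; reflexivity.
Qed.

Lemma look_0 k : look 0 k = 0.
Proof. reflexivity. Qed.

Lemma look_put k x m k' : look (put k x m) k' = if k =? k' then x else look m k'.
Proof.
  unfold look.
  assert (E : scan k' (put k x m) = if k =? k' then put k x m else m).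
  { unfold scan, put; cbn [Nat.eqb orb pred]; rewrite !p1_pair, p2_pair; reflexivity. }
  destruct (k =? k') eqn:Ek.
  - assert (H : forall j, Nat.iter j (scan k') (put k x m) = put k x m).
    { induction j as [|j IHj]; [reflexivity|rewrite Nat.iter_succ, IHj; exact E]. }
    rewrite H; unfold put; cbn [Nat.eqb pred]; rewrite p1_pair, p2_pair; reflexivity.
  - assert (H : Nat.iter (put k x m) (scan k') (put k x m) =
      Nat.iter m (scan k') m); [|rewrite H; reflexivity].
    unfold put at 1; rewrite Nat.iter_succ_r, E; apply scan_fixed.
    rewrite <- (p2_pair (pair k x) m) at 1; apply p2_le.
Qed.

Lemma pr_look a b : pr a -> pr b -> pr (fun o v => look (a o v) (b o v)).
Proof.
  apply (pr_comp2 (fun _ => look)).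
  assert (H : pr (fun _ v => Nat.iter (v 0) (scan (v 1)) (v 0))).
  { apply (pr_iter (fun _ v => scan (v 1))); unfold scan; pr. }
  unfold look; cbv zeta; pr.
Qed.

Lemma pr_put a b c : pr a -> pr b -> pr c ->
  pr (fun o v => put (a o v) (b o v) (c o v)).
Proof. intros Ha Hb Hc; unfold put; pr. Qed.
#[export] Hint Resolve pr_look pr_put : pr.

(** Positive and negative part, one of which is 0: codes are unique, and a move of the head is a
    simple case distinction. *)
Definition zcode (z : Z) : nat := pair (Z.to_nat z) (Z.to_nat (- z)).

Definition zmove (m : move) (c : nat) : nat :=
  match m with
  | Left => if p1 c =? 0 then pair 0 (S (p2 c)) else pair (pred (p1 c)) 0
  | Stay => c
  | Right => if p2 c =? 0 then pair (S (p1 c)) 0 else pair 0 (pred (p2 c))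
  end.

Lemma zmove_zcode m z : zmove m (zcode z) = zcode (z + displacement m).
Proof.
  unfold zcode; destruct m; cbn [zmove displacement]; rewrite ?p1_pair, ?p2_pair.
  - destruct (Nat.eqb_spec (Z.to_nat z) 0); f_equal; lia.
  - f_equal; lia.
  - destruct (Nat.eqb_spec (Z.to_nat (- z)) 0); f_equal; lia.
Qed.

Lemma pair_inj a b a' b' : pair a b = pair a' b' -> a = a' /\ b = b'.
Proof.
  intros H; split.
  - rewrite <- (p1_pair a b), H; apply p1_pair.
  - rewrite <- (p2_pair a b), H; apply p2_pair.
Qed.

Lemma pair_eqb a b a' b' : (pair a b =? pair a' b') = (a =? a') && (b =? b').
Proof.
  destruct (Nat.eqb_spec (pair a b) (pair a' b')) as [E|E].
  - apply pair_inj in E; destruct E as [-> ->]; rewrite !Nat.eqb_refl; reflexivity.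
  - destruct (Nat.eqb_spec a a'), (Nat.eqb_spec b b'); subst; cbn; auto; congruence.
Qed.

Lemma zcode_eqb z z' : (zcode z =? zcode z') = (z =? z')%Z.
Proof.
  unfold zcode; rewrite pair_eqb.
  destruct (Z.eqb_spec z z'), (Nat.eqb_spec (Z.to_nat z) (Z.to_nat z')),
    (Nat.eqb_spec (Z.to_nat (- z)) (Z.to_nat (- z'))); subst; cbn; auto; lia.
Qed.

(** A configuration is stored in a memory with these keys; the input tape is
    not stored but given by a function [I] on codes of integers. *)
Definition key_state : nat := pair 0 0.
Definition key_head (j : nat) : nat := pair 1 j.
Definition key_cell (j z : nat) : nat := pair (2 + j) z.

Definition sim_read (I : nat -> nat) (j m : nat) : nat :=
  if j =? input_tape then I (look m (key_head j))
  else look m (key_cell j (look m (key_head j))).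

Definition sim_applicable (I : nat -> nat) (m : nat) (r : rule) : bool :=
  (source r =? look m key_state) && (read r =? sim_read I (tape r) m).

Definition sim_execute (r : rule) (m : nat) : nat :=
  put key_state (target r)
    (put (key_head (tape r)) (zmove (shift r) (look m (key_head (tape r))))
      (if tape r =? input_tape then m
       else put (key_cell (tape r) (look m (key_head (tape r)))) (write r) m)).

Definition sim_step (M : machine) (I : nat -> nat) (m : nat) : nat :=
  match find (sim_applicable I m) M with
  | Some r => sim_execute r m
  | None => m
  end.

Definition sim (M : machine) (I : nat -> nat) (t : nat) : nat :=
  Nat.iter t (sim_step M I) 0.

Definition sim_halted (M : machine) (I : nat -> nat) (m : nat) : bool :=
  negb (existsb (sim_applicable I m) M).

Record encodes (inp : Z -> nat) (m : nat) (c : config) : Prop := {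
  enc_state : look m key_state = state c;
  enc_head : forall j, look m (key_head j) = zcode (head c j);
  enc_cell : forall j z, j <> input_tape -> look m (key_cell j (zcode z)) = cell c j z;
  enc_input : forall z, cell c input_tape z = inp z }.

Section Encoding.
Variables (M : machine) (I : nat -> nat) (inp : Z -> nat).
Hypothesis I_inp : forall z, I (zcode z) = inp z.

Lemma sim_applicable_spec (m : nat) (c : config) :
  encodes inp m c -> sim_applicable I m = applicable c.
Proof.
  intros [H1 H2 H3 H4]; apply functional_extensionality; intros r.
  unfold sim_applicable, applicable, sim_read; rewrite H1, H2.
  destruct (Nat.eqb_spec (tape r) input_tape) as [->|E].
  - rewrite I_inp, H4; reflexivity.
  - rewrite H3 by exact E; reflexivity.
Qed.

Lemma sim_spec (t : nat) : encodes inp (sim M I t) (run M inp t).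
Proof.
  induction t as [|t IH].
  (* The empty memory 0 encodes the initial configuration because state 0, the head code
     [zcode 0 = 0] and [blank] all agree with the default value of [look]. *)
  - split; intros; cbn; auto; rewrite ?look_0; try reflexivity.
    destruct (Nat.eqb_spec j input_tape); [contradiction|reflexivity].
  - change (sim M I (S t)) with (sim_step M I (sim M I t)).
    change (run M inp (S t)) with (step M (run M inp t)).
    set (m := sim M I t) in *; set (c := run M inp t) in *; clearbody m c.
    unfold sim_step, step; rewrite (sim_applicable_spec m c IH).
    destruct (find (applicable c) M) as [r|]; [|exact IH].
    destruct IH as [H1 H2 H3 H4].
    split; intros; unfold sim_execute, execute, key_state, key_head, key_cell in *;
      cbn [state head cell]; rewrite ?look_put, ?pair_eqb.
    + reflexivity.
    + cbn [Nat.eqb andb]; rewrite (Nat.eqb_sym (tape r)).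
      destruct (Nat.eqb_spec j (tape r)); subst.
      * rewrite H2; apply zmove_zcode.
      * destruct (Nat.eqb_spec (tape r) input_tape); [apply H2|].
        rewrite look_put, pair_eqb; cbn [Nat.eqb Nat.add andb]; apply H2.
    + cbn [Nat.eqb Nat.add andb].
      destruct (Nat.eqb_spec (tape r) input_tape) as [E|E].
      * destruct (Nat.eqb_spec j (tape r)); [congruence|].
        cbn [andb]; apply H3; assumption.
      * rewrite look_put, pair_eqb, H2, zcode_eqb; cbn [Nat.eqb Nat.add].
        rewrite (Nat.eqb_sym (tape r) j), (Z.eqb_sym _ z).
        destruct (Nat.eqb_spec j input_tape); [contradiction|].
        destruct (Nat.eqb_spec j (tape r)); subst; cbn [andb negb];
          [|apply H3; assumption].
        destruct (Z.eqb_spec z (head c (tape r))); [reflexivity|apply H3; assumption].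
    + rewrite Nat.eqb_refl, andb_false_r; apply H4.
Qed.

Lemma sim_halted_spec (t : nat) :
  sim_halted M I (sim M I t) = true <-> halted M (run M inp t).
Proof.
  unfold sim_halted, halted; rewrite (sim_applicable_spec _ _ (sim_spec t)).
  rewrite negb_true_iff, <- not_true_iff_false, existsb_exists.
  split.
  - intros H; destruct (find _ M) as [r|] eqn:E; [|reflexivity].
    apply find_some in E; destruct H; eauto.
  - intros H (r & Hr & Ha); rewrite (find_none _ _ H r Hr) in Ha; discriminate.
Qed.

Lemma sim_output (t m : nat) :
  look (sim M I t) (key_cell output_tape (pair m 0)) =
  cell (run M inp t) output_tape (Z.of_nat m).
Proof.
  rewrite <- (enc_cell _ _ _ (sim_spec t)) by discriminate.
  unfold zcode; do 3 f_equal; lia.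
Qed.
End Encoding.

Section Definability.
Variables (M : machine) (I : nat -> nat -> nat).
Hypothesis pr_I : pr (fun _ v => I (v 0) (v 1)).

Lemma prb_sim_applicable r :
  prb (fun _ v => sim_applicable (I (v 0)) (v 1) r).
Proof.
  unfold sim_applicable, sim_read; apply prb_and;
    unfold key_state, key_head, key_cell; [pr|].
  apply prb_eqb; [pr|]; apply pr_if; [pr| |pr].
  apply (pr_comp2 (fun _ => I)); pr.
Qed.

(** The machine is a fixed parameter, so [find] unfolds into nested conditionals with one case for
    each rule. *)
Lemma pr_sim_step : pr (fun _ v => sim_step M (I (v 0)) (v 1)).
Proof.
  induction M as [|r M' IH]; [cbn; pr|].
  apply (pr_ext (fun _ v => if sim_applicable (I (v 0)) (v 1) r
    then sim_execute r (v 1) else sim_step M' (I (v 0)) (v 1))).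
  - apply pr_if; [apply prb_sim_applicable| |exact IH].
    unfold sim_execute, key_state, key_head, key_cell.
    destruct (shift r); cbn [zmove]; pr.
  - intros _ v; unfold sim_step; cbn [find].
    destruct (sim_applicable _ _ r); reflexivity.
Qed.

Lemma pr_sim a t : pr a -> pr t -> pr (fun o v => sim M (I (a o v)) (t o v)).
Proof.
  apply (pr_comp2 (fun _ a t => sim M (I a) t)).
  apply (pr_iter (fun _ v => sim_step M (I (v 0)))); [pr|pr|].
  apply (pr_comp2 (fun _ a m => sim_step M (I a) m) _ _ pr_sim_step); pr.
Qed.

Lemma prb_sim_halted a m : pr a -> pr m ->
  prb (fun o v => sim_halted M (I (a o v)) (m o v)).
Proof.
  apply (pr_comp2 (fun _ a m => Nat.b2n (sim_halted M (I a) m))).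
  apply prb_not; induction M as [|r M' IH]; [apply (prb_const false)|].
  apply prb_or; [apply prb_sim_applicable|exact IH].
Qed.
End Definability.

(** * Symbols of unary words *)

Definition ustep (p : nat -> nat) (u : nat) : nat :=
  if p2 u =? 0 then pair (S (p1 u)) (p (S (p1 u))) else pair (p1 u) (pred (p2 u)).

(** The block to which symbol [m] of [unary p] belongs, and the number of
    strokes of that block from this symbol on. *)
Definition ustate (p : nat -> nat) (m : nat) : nat :=
  Nat.iter m (ustep p) (pair 0 (p 0)).

Lemma unary_ustate (p : baire) (m : nat) :
  unary p m = if p2 (ustate p m) =? 0 then comma else stroke.
Proof.
  (* The recursion of [unary] changes its sequence: on the way it consists of the rest [a] of block
     [k] and the later entries of [p]. *)
  assert (H : forall m k a,
    unary (fun n => match n with 0 => a | S n => p (k + S n) end) m =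
    if p2 (Nat.iter m (ustep p) (pair k a)) =? 0 then comma else stroke).
  { clear m; induction m as [|m IH]; intros k a.
    - cbn [Nat.iter nat_rect unary]; rewrite p2_pair; destruct a; reflexivity.
    - rewrite Nat.iter_succ_r; unfold ustep at 2; rewrite p1_pair, p2_pair.
      destruct a as [|a]; cbn [unary Nat.eqb pred].
      + rewrite <- IH; f_equal; apply functional_extensionality; intros [|n];
          f_equal; lia.
      + rewrite <- IH; f_equal; apply functional_extensionality; intros [|n];
          reflexivity. }
  unfold ustate; rewrite <- H; f_equal.
  apply functional_extensionality; intros [|n]; reflexivity.
Qed.

(** A machine needs an infinite input; by [run_agree] its first [len w] steps are the same for every
    completion of the word. *)
Definition pad (w i : nat) : nat := if i <? len w then get w i else 0.

Definition word_input (w z : nat) : nat :=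
  if p2 z =? 0 then
    (if p2 (ustate (pad w) (p1 z)) =? 0 then comma else stroke)
  else blank.

Definition num_input (n z : nat) : nat :=
  if (p2 z =? 0) && (p1 z <? n) then stroke else blank.

Lemma word_input_spec w z : word_input w (zcode z) = seq_word (pad w) z.
Proof.
  unfold word_input, seq_word, zcode; rewrite p1_pair, p2_pair, unary_ustate.
  destruct (Nat.eqb_spec (Z.to_nat (- z)) 0), (Z.ltb_spec z 0); auto; lia.
Qed.

Lemma num_input_spec n z : num_input n (zcode z) = num_word n z.
Proof.
  unfold num_input, num_word, zcode; rewrite p1_pair, p2_pair.
  destruct (Nat.eqb_spec (Z.to_nat (- z)) 0), (Nat.ltb_spec (Z.to_nat z) n),
    (Z.leb_spec 0 z), (Z.ltb_spec z (Z.of_nat n)); cbn; auto; lia.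
Qed.

Lemma pr_word_input : pr (fun _ v => word_input (v 0) (v 1)).
Proof.
  unfold word_input; apply pr_if; [pr| |pr]; apply pr_if; [|pr|pr].
  apply prb_eqb; [|pr]; apply pr_p2.
  apply (pr_comp2 (fun _ w m => ustate (pad w) m)); [|pr|pr].
  apply (pr_iter (fun _ v => ustep (pad (v 0)))); unfold ustep, pad; pr.
Qed.

Lemma pr_num_input : pr (fun _ v => num_input (v 0) (v 1)).
Proof. unfold num_input; pr. Qed.

(** * Finite runs depend on finite words *)

Lemma unary_agree (m : nat) : forall p p' : baire, (forall i, i <= m -> p i = p' i) ->
  unary p m = unary p' m.
Proof.
  induction m as [|m IH]; intros p p' H; cbn [unary]; rewrite (H 0) by lia;
    destruct (p' 0); auto; apply IH.
  - intros i Hi; apply H; lia.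
  - intros [|i] Hi; [reflexivity|apply H; lia].
Qed.

(** The input head is at most [t] after [t] steps, and [unary p] needs at least
    one symbol for each of the numbers [p i]. *)
Lemma run_agree (M : machine) (p p' : baire) (n : nat) :
  (forall i, i < n -> p i = p' i) -> forall t, t <= n ->
  let c := run M (seq_word p) t in let c' := run M (seq_word p') t in
  state c = state c' /\ (forall j, head c j = head c' j) /\
  (head c input_tape <= Z.of_nat t)%Z /\
  (forall j z, j <> input_tape -> cell c j z = cell c' j z) /\
  (forall z, cell c input_tape z = seq_word p z) /\
  (forall z, cell c' input_tape z = seq_word p' z).
Proof.
  intros Hp; induction t as [|t IH]; intros Ht; cbv zeta.
  - cbn; repeat split; auto; try lia.
    intros j z Hj; destruct (Nat.eqb_spec j input_tape); [contradiction|reflexivity].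
  - destruct (IH ltac:(lia)) as (H1 & H2 & H3 & H4 & H5 & H6); clear IH.
    change (run M (seq_word p) (S t)) with (step M (run M (seq_word p) t)).
    change (run M (seq_word p') (S t)) with (step M (run M (seq_word p') t)).
    set (c := run M (seq_word p) t) in *; set (c' := run M (seq_word p') t) in *.
    clearbody c c'.
    assert (E : applicable c = applicable c').
    { apply functional_extensionality; intros r; unfold applicable.
      rewrite H1, H2; f_equal; f_equal.
      destruct (Nat.eq_dec (tape r) input_tape) as [->|E]; [|auto].
      rewrite H5, H6, <- H2; unfold seq_word.
      destruct (Z.ltb_spec (head c input_tape) 0); [reflexivity|].
      apply unary_agree; intros i Hi; apply Hp; lia. }
    unfold step; rewrite E; destruct (find (applicable c') M) as [r|].
    2:{ repeat split; auto; lia. }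
    unfold execute; cbn [state head cell]; repeat split; auto.
    + intros j; rewrite H2; reflexivity.
    + destruct (_ =? _); [destruct (shift r); cbn [displacement]|]; lia.
    + intros j z Hj; rewrite H2, H4 by exact Hj; reflexivity.
    + intros z; rewrite Nat.eqb_refl, andb_false_r; apply H5.
    + intros z; rewrite Nat.eqb_refl, andb_false_r; apply H6.
Qed.

(** The length of the word is also the number of steps, so this is the content of the cell at time
    [len w] on every sequence that extends [w]. *)
Definition out (M : machine) (w m : nat) : nat :=
  look (sim M (word_input w) (len w)) (key_cell output_tape (pair m 0)).

Lemma out_spec (M : machine) (w m : nat) (r : baire) :
  (forall i, i < len w -> r i = get w i) ->
  out M w m = cell (run M (seq_word r) (len w)) output_tape (Z.of_nat m).
Proof.
  intros Hr; unfold out.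
  rewrite (sim_output M _ _ (word_input_spec w)).
  destruct (run_agree M (pad w) r (len w)) with (t := len w)
    as (_ & _ & _ & H & _); [|lia|apply H; discriminate].
  intros i Hi; rewrite Hr by exact Hi; unfold pad.
  destruct (Nat.ltb_spec i (len w)); [reflexivity|lia].
Qed.

Lemma pr_out M a b : pr a -> pr b -> pr (fun o v => out M (a o v) (b o v)).
Proof.
  intros Ha Hb; unfold out, key_cell.
  apply pr_look; [|pr]; apply (pr_sim M _ pr_word_input); pr.
Qed.
#[export] Hint Resolve pr_out : pr.

(** A computable function need not be primitive recursive and is handled through its graph with a
    time bound. Two cells identify the value, because the output is known to be one block of
    strokes. *)
Definition value (M : machine) (n x t : nat) : bool :=
  let c := sim M (num_input n) t in
  sim_halted M (num_input n) c &&
  (look c (key_cell output_tape (pair x 0)) =? blank) &&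
  ((x =? 0) || (look c (key_cell output_tape (pair (pred x) 0)) =? stroke)).

Lemma halted_unique (M : machine) (inp : Z -> nat) (t t' : nat) :
  halted M (run M inp t) -> halted M (run M inp t') -> run M inp t = run M inp t'.
Proof.
  assert (H : forall t t', t <= t' -> halted M (run M inp t) ->
    run M inp t' = run M inp t).
  { intros s s' Hle Hs; replace s' with ((s' - s) + s) by lia.
    unfold run; rewrite Nat.iter_add; apply halted_stays, Hs. }
  intros Ht Ht'; destruct (le_lt_dec t t'); [symmetry|]; apply H; auto; lia.
Qed.

Section Value.
Variables (M : machine) (f : nat -> nat).
Hypothesis M_computes : forall n, exists t, halted M (run M (num_word n) t) /\
  forall m : nat, cell (run M (num_word n) t) output_tape (Z.of_nat m) =
    num_word (f n) (Z.of_nat m).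

Lemma num_word_nat n m :
  num_word n (Z.of_nat m) = if m <? n then stroke else blank.
Proof.
  unfold num_word; destruct (Z.leb_spec 0 (Z.of_nat m)),
    (Z.ltb_spec (Z.of_nat m) (Z.of_nat n)), (Nat.ltb_spec m n); auto; lia.
Qed.

Lemma value_sound n x t : value M n x t = true -> x = f n.
Proof.
  unfold value; cbv zeta; rewrite !andb_true_iff, orb_true_iff, !Nat.eqb_eq.
  rewrite !(sim_output M _ _ (num_input_spec n)).
  rewrite (sim_halted_spec M _ _ (num_input_spec n)).
  intros [[Hh Hb] Hs]; destruct (M_computes n) as (t' & Hh' & Hc).
  rewrite (halted_unique _ _ _ _ Hh Hh'), Hc, num_word_nat in *.
  destruct (Nat.ltb_spec x (f n)); [discriminate|].
  destruct Hs as [->|Hs]; [lia|].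
  destruct (Nat.ltb_spec (pred x) (f n)); [lia|discriminate].
Qed.

Lemma value_complete n : exists t, value M n (f n) t = true.
Proof.
  destruct (M_computes n) as (t & Hh & Hc); exists t.
  unfold value; cbv zeta; rewrite !andb_true_iff, orb_true_iff, !Nat.eqb_eq.
  rewrite !(sim_output M _ _ (num_input_spec n)).
  rewrite (sim_halted_spec M _ _ (num_input_spec n)), !Hc, !num_word_nat.
  rewrite Nat.ltb_irrefl; repeat split; auto.
  destruct (f n) as [|k]; [auto|right]; cbn [pred].
  destruct (Nat.ltb_spec k (S k)); [reflexivity|lia].
Qed.
End Value.

Lemma prb_value M a b c : pr a -> pr b -> pr c ->
  prb (fun o v => value M (a o v) (b o v) (c o v)).
Proof.
  intros Ha Hb Hc; unfold value, key_cell; cbv zeta.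
  assert (Hs : pr (fun o v => sim M (num_input (a o v)) (c o v)))
    by (apply (pr_sim M _ pr_num_input); pr).
  apply prb_and; [apply prb_and|]; [apply (prb_sim_halted M _ pr_num_input)|..]; pr.
Qed.
#[export] Hint Resolve prb_value : pr.

(** The block containing position [B] of the input word and the number of
    strokes of that block before [B]. *)
Definition parse (o : nat -> nat) (B : nat) : nat :=
  nat_rect (fun _ => nat) (pair 0 0)
    (fun i u => if o i =? comma then pair (S (p1 u)) 0
                else pair (p1 u) (S (p2 u))) B.

Lemma pr_parse a : pr a -> pr (fun o v => parse o (a o v)).
Proof.
  intros Ha; apply (pr_rec (fun _ _ => pair 0 0)
    (fun o _ i u => if o i =? comma then pair (S (p1 u)) 0
                    else pair (p1 u) (S (p2 u)))); [pr|pr|].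
  apply pr_if; [apply prb_eqb; [apply pr_sym|]|..]; pr.
Qed.
#[export] Hint Resolve pr_parse : pr.

(** [parse] counts the strokes of the current block before [B], [ustate] those from [B] on; together
    they are the whole block. *)
Lemma parse_ustate (q : baire) B :
  p1 (parse (unary q) B) = p1 (ustate q B) /\
  p2 (parse (unary q) B) + p2 (ustate q B) = q (p1 (ustate q B)).
Proof.
  induction B as [|B [IH1 IH2]].
  - cbn [parse nat_rect ustate Nat.iter]; rewrite !p1_pair, !p2_pair; auto.
  - change (parse (unary q) (S B)) with
      (if unary q B =? comma then pair (S (p1 (parse (unary q) B))) 0
       else pair (p1 (parse (unary q) B)) (S (p2 (parse (unary q) B)))).
    change (ustate q (S B)) with (ustep q (ustate q B)).
    rewrite unary_ustate; unfold ustep.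
    destruct (Nat.eqb_spec (p2 (ustate q B)) 0) as [E|E]; cbn [Nat.eqb comma stroke].
    + rewrite !p1_pair, !p2_pair; auto.
    + rewrite !p1_pair, !p2_pair; split; [auto|lia].
Qed.

Lemma parse_sound (q : baire) B : unary q B = comma ->
  p2 (parse (unary q) B) = q (p1 (parse (unary q) B)).
Proof.
  destruct (parse_ustate q B) as [H1 H2]; rewrite unary_ustate.
  destruct (Nat.eqb_spec (p2 (ustate q B)) 0) as [E|E]; [|discriminate].
  intros _; rewrite H1; lia.
Qed.

(** A term cannot search the input without bound, so an entry is read off at a guessed end of its
    block; here a correct guess exists, and [parse_sound] validates it. *)
Lemma parse_complete (q : baire) n :
  exists B, unary q B = comma /\ p1 (parse (unary q) B) = n.
Proof.
  assert (H : forall a B, p2 (ustate q B) = a ->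
    exists B', p2 (ustate q B') = 0 /\ p1 (ustate q B') = p1 (ustate q B)).
  { induction a as [|a IH]; intros B Ha; [eauto|].
    assert (E : ustate q (S B) = pair (p1 (ustate q B)) a)
      by (change (ustate q (S B)) with (ustep q (ustate q B)); unfold ustep;
          rewrite Ha; reflexivity).
    destruct (IH (S B)) as (B' & H1 & H2); rewrite E, ?p1_pair, ?p2_pair in *; eauto. }
  assert (exists B, p2 (ustate q B) = 0 /\ p1 (ustate q B) = n) as (B & H1 & H2).
  { induction n as [|n (B & H1 & H2)].
    - destruct (H _ 0 eq_refl) as (B & H1 & H2); exists B; split; [auto|].
      rewrite H2; apply p1_pair.
    - assert (E : ustate q (S B) = pair (S n) (q (S n)))
        by (change (ustate q (S B)) with (ustep q (ustate q B)); unfold ustep;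
            rewrite H1, H2; reflexivity).
      destruct (H _ (S B) eq_refl) as (B' & H3 & H4); exists B'; split; [auto|].
      rewrite H4, E; apply p1_pair. }
  exists B; rewrite unary_ustate, H1; split; [reflexivity|].
  rewrite (proj1 (parse_ustate q B)); exact H2.
Qed.

(** * Machine numbers *)

Definition code_move (m : move) : nat :=
  match m with Left => 0 | Stay => 1 | Right => 2 end.

Definition code_rule (r : rule) : nat :=
  pair (source r) (pair (tape r) (pair (read r) (pair (write r)
    (pair (code_move (shift r)) (target r))))).

Fixpoint code_machine (M : machine) : nat :=
  match M with [] => 0 | r :: M => S (pair (code_rule r) (code_machine M)) end.

Lemma rule_of_code r : rule_of (code_rule r) = r.
Proof.
  unfold rule_of, code_rule, pair; rewrite !cancel_of_to.
  destruct r as [s j a b [| |] s']; reflexivity.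
Qed.

Lemma machine_of_code M : machine_of (code_machine M) = M.
Proof.
  assert (H : forall n, code_machine M <= n -> rules_of n (code_machine M) = M).
  { induction M as [|r M IH]; intros n Hn; [destruct n; reflexivity|].
    cbn [code_machine] in *; destruct n as [|n]; [lia|]; cbn [rules_of].
    unfold pair at 1; rewrite cancel_of_to, rule_of_code, IH; [reflexivity|].
    assert (Hp := p2_le (pair (code_rule r) (code_machine M))).
    rewrite p2_pair in Hp; lia. }
  apply H; reflexivity.
Qed.

Lemma pr_code_load d M :
  pr (fun _ v => code_machine (load d (v 0) M)).
Proof.
  apply (pr_ext (fun _ v => nat_rect (fun _ => nat) (code_machine M)
      (fun k x => S (pair (code_rule (Rule (S (d + k)) 2 blank stroke Right (d + k))) x))
      (v 0))).
  - apply (pr_rec (fun _ _ => code_machine M) (fun _ _ k x =>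
      S (pair (code_rule (Rule (S (d + k)) 2 blank stroke Right (d + k))) x)));
      unfold code_rule; cbn [source tape read write shift target code_move]; pr.
  - intros _ v.
    induction (v 0) as [|n IH]; [reflexivity|cbn [nat_rect load code_machine]].
    rewrite IH; reflexivity.
Qed.

Lemma pr_code_iteration g e a : pr a ->
  pr (fun o v => code_machine (iteration g e (a o v))).
Proof.
  apply (pr_comp1 (fun _ n => code_machine (iteration g e n))).
  unfold iteration; cbn [code_machine].
  apply pr_S, pr_pair; [|apply pr_code_load].
  unfold code_rule; cbn [source tape read write shift target code_move]; pr.
Qed.

Lemma seq_word_symbol p z :
  seq_word p z = blank \/ seq_word p z = stroke \/ seq_word p z = comma.
Proof.
  unfold seq_word; destruct (z <? 0)%Z; [auto|].
  rewrite unary_ustate; destruct (_ =? _); auto.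
Qed.

Lemma num_word_symbol n z :
  num_word n z = blank \/ num_word n z = stroke \/ num_word n z = comma.
Proof. unfold num_word; destruct (_ && _); auto. Qed.

Lemma seq_word_nat p : (fun n => seq_word p (Z.of_nat n)) = unary p.
Proof.
  apply functional_extensionality; intros n; unfold seq_word.
  destruct (Z.ltb_spec (Z.of_nat n) 0); [lia|]; rewrite Nat2Z.id; reflexivity.
Qed.

(** The machine with hard-wired start [pair a 0] counts the second component up to a witness. The
    value 3 of [e] stops the iteration, the value 0 continues it silently. *)
Lemma halting_problem_index (P : nat -> nat -> bool) :
  prb (fun _ v => P (v 0) (v 1)) -> exists f : nat -> nat,
    pr (fun _ v => f (v 0)) /\
    forall a, halting_problem (f a) = 0 <-> ~ exists w, P a w = true.
Proof.
  intros HP.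
  assert (Hg : pr (fun _ v => pair (p1 (v 0)) (S (p2 (v 0))))) by pr.
  assert (He : pr (fun _ v => if P (p1 (v 0)) (p2 (v 0)) then 3 else 0)).
  { apply pr_if; [|pr|pr].
    apply (pr_comp2 (fun _ a w => Nat.b2n (P a w))); [exact HP|pr|pr]. }
  destruct Hg as [g Hg], He as [e He].
  exists (fun a => code_machine (iteration g e (pair a 0))); split.
  - apply pr_code_iteration; pr.
  - intros a; unfold halting_problem; rewrite machine_of_code.
    assert (H : halts (iteration g e (pair a 0)) (seq_word (fun _ => 0)) <->
      exists w, P a w = true).
    { rewrite iteration_halts by apply seq_word_symbol.
      assert (E : forall j, Nat.iter j (fun s => eval (fun n =>
        seq_word (fun _ => 0) (Z.of_nat n)) g (fun _ => s)) (pair a 0) = pair a j).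
      { induction j as [|j IH]; [reflexivity|].
        rewrite Nat.iter_succ, IH, Hg, p1_pair, p2_pair; reflexivity. }
      split; intros [j Hj]; exists j; revert Hj; rewrite E, He, p1_pair, p2_pair;
        destruct (P a j); auto; intros; try lia; discriminate. }
    destruct (excluded_middle_informative _); split; intros; try tauto; lia.
Qed.

(** Here [n] is the input and not part of the machine. The counter codes a guess for [n] together
    with a witness, and the guess is checked on the input cells around the end of the block of
    strokes. *)
Lemma semidecidable (P : nat -> nat -> bool) :
  prb (fun _ v => P (v 0) (v 1)) ->
  exists i, forall n, W i n <-> exists w, P n w = true.
Proof.
  intros HP.
  assert (Hg : pr (fun _ v => S (v 0))) by pr.
  set (Q := fun (o : nat -> nat) w => (o (p1 w) =? blank) &&
    ((p1 w =? 0) || (o (pred (p1 w)) =? stroke)) && P (p1 w) (p2 w)).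
  assert (He : pr (fun o v => if Q o (v 0) then 3 else 0)).
  { apply pr_if; [|pr|pr]; unfold Q.
    apply prb_and; [apply prb_and; [|apply prb_or; [pr|]]|].
    - apply prb_eqb; [apply pr_sym|]; pr.
    - apply prb_eqb; [apply pr_sym|]; pr.
    - apply (pr_comp2 (fun _ a w => Nat.b2n (P a w))); [exact HP|pr|pr]. }
  destruct Hg as [g Hg], He as [e He].
  exists (code_machine (iteration g e 0)); intros n; unfold W.
  rewrite machine_of_code, iteration_halts by apply num_word_symbol.
  assert (E : forall j, Nat.iter j (fun s => eval (fun m =>
    num_word n (Z.of_nat m)) g (fun _ => s)) 0 = j).
  { induction j as [|j IH]; [reflexivity|].
    rewrite Nat.iter_succ, IH, Hg; reflexivity. }
  split.
  - intros [j Hj]; revert Hj; rewrite E, He.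
    destruct (Q _ j) eqn:EQ; [intros _|lia].
    unfold Q in EQ; rewrite !andb_true_iff, orb_true_iff, !Nat.eqb_eq,
      !num_word_nat in EQ.
    destruct EQ as [[H1 H2] H3]; exists (p2 j).
    replace n with (p1 j); [exact H3|].
    destruct (Nat.ltb_spec (p1 j) n); [discriminate|].
    destruct H2 as [H2|H2]; [lia|].
    destruct (Nat.ltb_spec (pred (p1 j)) n); [lia|discriminate].
  - intros [w Hw]; exists (pair n w); rewrite E, He.
    replace (Q _ (pair n w)) with true; [lia|symmetry].
    unfold Q; rewrite p1_pair, p2_pair, !andb_true_iff, orb_true_iff, !Nat.eqb_eq,
      !num_word_nat, Nat.ltb_irrefl; repeat split; auto.
    destruct n as [|n]; [auto|right]; cbn [pred].
    destruct (Nat.ltb_spec n (S n)); [reflexivity|lia].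
Qed.

(** * Uniqueness of outputs *)

Lemma unary_injective (q q' : baire) : (forall m, unary q m = unary q' m) -> q = q'.
Proof.
  intros H; apply functional_extensionality in H.
  apply functional_extensionality; intros n.
  destruct (parse_complete q n) as (B & HB & E).
  rewrite <- E at 1; rewrite <- parse_sound by exact HB.
  rewrite H in HB, E |- *; rewrite parse_sound, E by exact HB; reflexivity.
Qed.

(** Makes [produces M] the graph of a [pfun], from which the final realizer is built. *)
Lemma produces_unique (M : machine) (p q q' : baire) :
  produces M p q -> produces M p q' -> q = q'.
Proof.
  intros H H'; apply unary_injective; intros m.
  destruct (H m) as [t Ht], (H' m) as [t' Ht'].
  rewrite <- (Ht (Nat.max t t')), <- (Ht' (Nat.max t t')) by lia; reflexivity.
Qed.

(** * Open sets of a computable metric space *)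

Lemma half_pow_pos n : (0 < (/ 2) ^ n)%R.
Proof. apply pow_lt; lra. Qed.

Lemma half_pow_inv n : ((/ 2) ^ n * INR (2 ^ n) = 1)%R.
Proof.
  rewrite pow_INR; change (INR 2) with 2%R.
  rewrite <- Rpow_mult_distr, Rinv_l by lra; apply pow1.
Qed.

Lemma half_pow_small (eps : R) : (0 < eps)%R -> exists n, ((/ 2) ^ n < eps)%R.
Proof.
  intros He; destruct (pow_lt_1_zero (/ 2) ltac:(rewrite Rabs_pos_eq; lra) eps He)
    as [n Hn]; exists n; specialize (Hn n (le_n n)).
  rewrite Rabs_pos_eq in Hn; [exact Hn|]; apply Rlt_le, half_pow_pos.
Qed.

(** The inequality [rational x + 2^-k + 2^-a < 2^-b] multiplied by its
    denominators. *)
Definition rational_test (x k a b : nat) : bool :=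
  let i := p1 (p1 x) in let j := p2 (p1 x) in let d := S (p2 x) in
  i * (2 ^ k * 2 ^ a * 2 ^ b) + d * (2 ^ a * 2 ^ b) + d * (2 ^ k * 2 ^ b) <?
  j * (2 ^ k * 2 ^ a * 2 ^ b) + d * (2 ^ k * 2 ^ a).

Lemma rational_eq x :
  rational x = ((INR (p1 (p1 x)) - INR (p2 (p1 x))) / INR (S (p2 x)))%R.
Proof.
  unfold rational, p1, p2; destruct (of_nat x) as [ij k]; cbn [fst snd].
  destruct (of_nat ij) as [i j]; cbn [fst snd]; rewrite S_INR; reflexivity.
Qed.

Lemma rational_test_iff x k a b : rational_test x k a b = true <->
  (rational x + (/ 2) ^ k + (/ 2) ^ a < (/ 2) ^ b)%R.
Proof.
  unfold rational_test; cbv zeta; rewrite Nat.ltb_lt, rational_eq.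
  set (i := p1 (p1 x)); set (j := p2 (p1 x)); set (d := S (p2 x)).
  assert (Hd : (0 < INR d)%R) by (apply lt_0_INR; unfold d; lia).
  assert (Hk := half_pow_inv k); assert (Ha := half_pow_inv a).
  assert (Hb := half_pow_inv b).
  assert (Hk0 := half_pow_pos k); assert (Ha0 := half_pow_pos a).
  assert (Hb0 := half_pow_pos b).
  assert (HP : forall n, (0 < INR (2 ^ n))%R)
    by (intros n; apply lt_0_INR;
        assert (2 ^ n <> 0) by (apply Nat.pow_nonzero; lia); lia).
  assert (HK := HP k); assert (HA := HP a); assert (HB := HP b).
  set (D := (INR d * (INR (2 ^ k) * INR (2 ^ a) * INR (2 ^ b)))%R).
  assert (HD : (0 < D)%R) by (unfold D; repeat apply Rmult_lt_0_compat; auto).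
  assert (E1 : (INR (i * (2 ^ k * 2 ^ a * 2 ^ b) + d * (2 ^ a * 2 ^ b) +
      d * (2 ^ k * 2 ^ b)) - INR (j * (2 ^ k * 2 ^ a * 2 ^ b) + d * (2 ^ k * 2 ^ a)) =
    D * ((INR i - INR j) / INR d + (/ 2) ^ k + (/ 2) ^ a - (/ 2) ^ b))%R).
  { rewrite !plus_INR, !mult_INR; unfold D.
    replace ((/ 2) ^ k)%R with (/ INR (2 ^ k))%R
      by (apply (Rmult_eq_reg_r (INR (2 ^ k))); [rewrite Hk; field|]; lra).
    replace ((/ 2) ^ a)%R with (/ INR (2 ^ a))%R
      by (apply (Rmult_eq_reg_r (INR (2 ^ a))); [rewrite Ha; field|]; lra).
    replace ((/ 2) ^ b)%R with (/ INR (2 ^ b))%R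
      by (apply (Rmult_eq_reg_r (INR (2 ^ b))); [rewrite Hb; field|]; lra).
    field; repeat split; lra. }
  split; intros H.
  - apply lt_INR in H.
    assert (H' : (D * ((INR i - INR j) / INR d + (/ 2) ^ k + (/ 2) ^ a -
      (/ 2) ^ b) < 0)%R)
      by lra.
    apply (Rmult_lt_reg_l D); [exact HD|]; lra.
  - apply INR_lt.
    assert (H' : (D * ((INR i - INR j) / INR d + (/ 2) ^ k + (/ 2) ^ a -
      (/ 2) ^ b) < D * 0)%R)
      by (apply Rmult_lt_compat_l; lra).
    lra.
Qed.

Lemma prb_rational_test x k a b : pr x -> pr k -> pr a -> pr b ->
  prb (fun o v => rational_test (x o v) (k o v) (a o v) (b o v)).
Proof. intros Hx Hk Ha Hb; unfold rational_test; cbv zeta; pr. Qed.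
#[export] Hint Resolve prb_rational_test : pr.

Definition extends (s t : nat) : bool :=
  (len s <? len t) && bforall (len s) (fun i => get t i =? get s i).

Lemma extends_iff s t : extends s t = true <->
  len s < len t /\ forall i, i < len s -> get t i = get s i.
Proof.
  unfold extends; rewrite andb_true_iff, Nat.ltb_lt, bforall_iff.
  split; intros [H1 H2]; (split; [auto|]); intros i Hi; apply Nat.eqb_eq; auto.
Qed.

Lemma prb_extends a b : pr a -> pr b -> prb (fun o v => extends (a o v) (b o v)).
Proof.
  apply (pr_comp2 (fun _ s t => Nat.b2n (extends s t))).
  apply prb_and; [pr|].
  apply (prb_forall (fun _ v i => get (v 1) i =? get (v 0) i)); pr.
Qed.
#[export] Hint Resolve prb_extends : pr.

Lemma pr_comp5 f a b c d e :
  pr (fun o v => f o (v 0) (v 1) (v 2) (v 3) (v 4)) ->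
  pr a -> pr b -> pr c -> pr d -> pr e ->
  pr (fun o v => f o (a o v) (b o v) (c o v) (d o v) (e o v)).
Proof.
  intros Hf Ha Hb Hc Hd He.
  apply (pr_let _ _ He (pr_let _ _ (pr_rename _ S Hd)
    (pr_let _ _ (pr_rename _ (fun i => S (S i)) Hc)
    (pr_let _ _ (pr_rename _ (fun i => S (S (S i))) Hb)
    (pr_let _ _ (pr_rename _ (fun i => S (S (S (S i)))) Ha) Hf))))).
Qed.

Section Metric.
Variable X : computable_metric_space.
Local Notation al := (@alpha X).
Local Notation ds := (@dist (space X)).

(** Formal inclusion of the ball of radius 2^-a around [al i] in the ball of radius 2^-b around
    [al j]; being a strict inequality, it is semidecidable. *)
Definition near (i j a b : nat) : Prop :=
  (ds (al i) (al j) + (/ 2) ^ a < (/ 2) ^ b)%R.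

(** The ball of radius [2^-l] around [al c] consists of limits of names that
    extend the word [t]. *)
Definition fits (t c l : nat) : Prop :=
  forall k, k < len t -> near c (get t k) l (S k).

(** Letter [k] has error below 2^-(k+1), half of what a name allows, so two such errors fit into the
    Cauchy condition in [limit_word_name]. *)
Definition compatible (t : nat) (x : X) : Prop :=
  forall k, k < len t -> (ds x (al (get t k)) < (/ 2) ^ S k)%R.

Lemma dist_self (x : X) : ds x x = 0%R.
Proof. apply (proj2 (dist_refl _ x x)); reflexivity. Qed.

Lemma fits_compatible t c l x :
  fits t c l -> (ds x (al c) < (/ 2) ^ l)%R -> compatible t x.
Proof.
  intros H Hx k Hk; specialize (H k Hk); unfold near in H.
  assert (Ht := dist_tri (space X) x (al (get t k)) (al c)).
  lra.
Qed.

(** Finitely many strict inequalities have a common slack, and a dense point close enough to [x]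
    serves as centre. The last inequality puts the whole ball within [eps] of [x]. *)
Lemma compatible_shrink t x (eps : R) : compatible t x -> (0 < eps)%R ->
  exists c l, fits t c l /\ (ds x (al c) < (/ 2) ^ l)%R /\ (2 * (/ 2) ^ l < eps)%R.
Proof.
  intros Ht He.
  assert (exists d, (0 < d)%R /\
    forall k, k < len t -> (ds x (al (get t k)) + d <= (/ 2) ^ S k)%R) as (d & Hd & Hk).
  { unfold compatible in Ht; induction (len t) as [|n IH].
    - exists 1%R; split; [lra|lia].
    - destruct IH as (d & Hd & H); [auto|]; specialize (Ht n (Nat.lt_succ_diag_r n)).
      exists (Rmin d ((/ 2) ^ S n - ds x (al (get t n)))%R); split.
      + apply Rmin_glb_lt; lra.
      + intros k Hk; destruct (Nat.eq_dec k n) as [->|].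
        * assert (Hm := Rmin_r d ((/ 2) ^ S n - ds x (al (get t n)))%R); lra.
        * assert (Hm := Rmin_l d ((/ 2) ^ S n - ds x (al (get t n)))%R).
          specialize (H k ltac:(lia)); lra. }
  destruct (half_pow_small (Rmin d eps / 2)%R) as [l Hl].
  { assert (0 < Rmin d eps)%R by (apply Rmin_glb_lt; auto); lra. }
  assert (H1 := Rmin_l d eps); assert (H2 := Rmin_r d eps).
  destruct (alpha_dense X x ((/ 2) ^ l)%R (half_pow_pos l)) as [c Hc].
  exists c, l; split; [|split; [exact Hc|lra]].
  intros k Hkt; specialize (Hk k Hkt); unfold near.
  assert (H := dist_tri (space X) (al c) (al (get t k)) x).
  rewrite (dist_sym _ (al c) x) in H; lra.
Qed.

Lemma compatible_extend t x (eps : R) : compatible t x -> (0 < eps)%R ->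
  exists u c l, extends t u = true /\ fits u c l /\
    (ds x (al c) < (/ 2) ^ l)%R /\ (2 * (/ 2) ^ l < eps)%R.
Proof.
  intros Ht He.
  destruct (compatible_shrink t x (Rmin eps ((/ 2) ^ S (len t)))%R Ht)
    as (c & l & H1 & H2 & H3).
  { apply Rmin_glb_lt; [exact He|apply half_pow_pos]. }
  assert (H4 := Rmin_l eps ((/ 2) ^ S (len t))%R).
  assert (H5 := Rmin_r eps ((/ 2) ^ S (len t))%R).
  (* The new letter is the centre itself, at distance 0 from [c]; so the ball only has to be smaller
     than the tolerance of the new position, whence the [Rmin] above. *)
  destruct (word_exists (fun i => if i <? len t then get t i else c) (S (len t)))
    as (u & Hu & Hg).
  exists u, c, l; repeat split; auto; [| |lra].
  - apply extends_iff; split; [lia|]; intros i Hi; rewrite Hg by lia.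
    destruct (Nat.ltb_spec i (len t)); [reflexivity|lia].
  - intros k Hk; rewrite Hg by lia; destruct (Nat.ltb_spec k (len t)); [auto|].
    unfold near; rewrite dist_self; assert (k = len t) by lia; subst k.
    assert (Hp := half_pow_pos l); lra.
Qed.

Lemma delta_dist (p : baire) (x : X) (n : nat) :
  delta p x -> (ds x (al (p n)) <= (/ 2) ^ n)%R.
Proof.
  intros [H1 H2]; apply Rnot_lt_le; intros H.
  destruct (H2 (ds x (al (p n)) - (/ 2) ^ n)%R) as [N HN]; [lra|].
  specialize (HN (Nat.max N n) (Nat.le_max_l _ _)).
  specialize (H1 n (Nat.max N n) (Nat.le_max_r _ _)).
  assert (Ht := dist_tri (space X) x (al (p n)) (al (p (Nat.max N n)))).
  rewrite (dist_sym _ x (al (p (Nat.max N n)))) in Ht.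
  lra.
Qed.

Variables (M_dist : machine) (f_dist : nat -> nat).
Hypothesis M_computes : forall n, exists t, halted M_dist (run M_dist (num_word n) t) /\
  forall m : nat, cell (run M_dist (num_word n) t) output_tape (Z.of_nat m) =
    num_word (f_dist n) (Z.of_nat m).
Hypothesis f_dist_spec : forall i j k, (Rabs (rational
  (f_dist (to_nat (to_nat (i, j), k))) - ds (al i) (al j)) < (/ 2) ^ k)%R.

(** [T] bounds a search for a precision, a rational approximation of the distance and a running time
    that confirms it. The test is monotone in [T], so several tests can share one bound. *)
Definition near_test (i j a b T : nat) : bool :=
  bexists T (fun u => let k := p1 (p1 u) in let x := p2 (p1 u) in
    value M_dist (pair (pair i j) k) x (p2 u) && rational_test x k a b).

Lemma near_test_sound i j a b T : near_test i j a b T = true -> near i j a b.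
Proof.
  unfold near_test; rewrite bexists_iff; intros (u & _ & H); cbv beta zeta in H.
  apply andb_true_iff in H; destruct H as [H1 H2].
  apply (value_sound M_dist f_dist M_computes) in H1; rewrite H1 in H2.
  apply rational_test_iff in H2; unfold near.
  assert (H := f_dist_spec i j (p1 (p1 u))); apply Rabs_def2 in H.
  unfold pair in H2; lra.
Qed.

Lemma near_test_complete i j a b : near i j a b ->
  exists T, forall T', T <= T' -> near_test i j a b T' = true.
Proof.
  unfold near; intros H.
  destruct (half_pow_small (((/ 2) ^ b - (/ 2) ^ a - ds (al i) (al j)) / 2)%R) as [k Hk];
    [lra|].
  destruct (value_complete M_dist f_dist M_computes (pair (pair i j) k)) as [t Ht].
  exists (S (pair (pair k (f_dist (pair (pair i j) k))) t)); intros T' HT.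
  unfold near_test; rewrite bexists_iff; eexists; split; [exact HT|cbv beta zeta].
  rewrite !p1_pair, !p2_pair, Ht; apply rational_test_iff.
  assert (Hf := f_dist_spec i j k); apply Rabs_def2 in Hf; unfold pair; lra.
Qed.

Lemma prb_near_test i j a b T : pr i -> pr j -> pr a -> pr b -> pr T ->
  prb (fun o v => near_test (i o v) (j o v) (a o v) (b o v) (T o v)).
Proof.
  apply (pr_comp5 (fun _ i j a b T => Nat.b2n (near_test i j a b T))).
  unfold near_test; cbv zeta.
  apply (prb_exists (fun _ v u =>
    value M_dist (pair (pair (v 0) (v 1)) (p1 (p1 u))) (p2 (p1 u)) (p2 u) &&
    rational_test (p2 (p1 u)) (p1 (p1 u)) (v 2) (v 3))); pr.
Qed.
Hint Resolve prb_near_test : pr.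

Definition fits_test (t c l T : nat) : bool :=
  bforall (len t) (fun k => near_test c (get t k) l (S k) T).

Lemma fits_test_sound t c l T : fits_test t c l T = true -> fits t c l.
Proof.
  unfold fits_test; rewrite bforall_iff; intros H k Hk.
  apply (near_test_sound _ _ _ _ T), H, Hk.
Qed.

Lemma fits_test_complete t c l : fits t c l ->
  exists T, forall T', T <= T' -> fits_test t c l T' = true.
Proof.
  unfold fits, fits_test; intros H.
  assert (exists T, forall T', T <= T' -> forall k, k < len t ->
    near_test c (get t k) l (S k) T' = true) as [T HT].
  { induction (len t) as [|n IH]; [exists 0; lia|].
    destruct IH as [T HT]; [auto|].
    destruct (near_test_complete _ _ _ _ (H n (Nat.lt_succ_diag_r n))) as [T1 HT1].
    exists (Nat.max T T1); intros T' HT' k Hk.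
    destruct (Nat.eq_dec k n) as [->|]; [apply HT1|apply HT]; lia. }
  exists T; intros T' HT'; apply bforall_iff; auto.
Qed.

Lemma prb_fits_test t c l T : pr t -> pr c -> pr l -> pr T ->
  prb (fun o v => fits_test (t o v) (c o v) (l o v) (T o v)).
Proof.
  apply (pr_comp4 (fun _ t c l T => Nat.b2n (fits_test t c l T))).
  apply (prb_forall (fun _ v k => near_test (v 1) (get (v 0) k) (v 2) (S k) (v 3))); pr.
Qed.
Hint Resolve prb_fits_test : pr.

Definition radius_code (l : nat) : nat := pair (pair 1 0) (pred (2 ^ l)).

Lemma rational_radius_code l : rational (radius_code l) = ((/ 2) ^ l)%R.
Proof.
  rewrite rational_eq; unfold radius_code; rewrite !p1_pair, !p2_pair.
  assert (2 ^ l <> 0) by (apply Nat.pow_nonzero; lia).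
  rewrite Nat.succ_pred by assumption.
  assert (Hi := half_pow_inv l); assert (Hp := half_pow_pos l).
  assert (INR (2 ^ l) <> 0)%R by (apply not_0_INR; assumption).
  cbn [INR]; apply (Rmult_eq_reg_r (INR (2 ^ l))); [rewrite Hi; field|]; assumption.
Qed.

Lemma ball_pair c r x : ball X (pair c r) x <-> (ds x (al c) < rational r)%R.
Proof. unfold ball, pair; rewrite cancel_of_to; reflexivity. Qed.

(** * Changes of an output cell and genericity *)

Variable M : machine.

Definition changes (s m t : nat) : Prop :=
  extends s t = true /\ out M t m <> out M s m.

Lemma change_open (s m : nat) : exists i, forall x, U X i x <->
  exists t c l, changes s m t /\ fits t c l /\ (ds x (al c) < (/ 2) ^ l)%R.
Proof.
  (* [n] is a ball with centre [p1 n], and [w] codes the word [t], the exponent [l] and the bound of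
     the test. Only radii of the form 2^-l are enumerated, which yields the same union. *)
  set (P := fun n w => let t := p1 (p1 w) in let l := p2 (p1 w) in
    (p2 n =? radius_code l) && extends s t && fits_test t (p1 n) l (p2 w) &&
    negb (out M t m =? out M s m)).
  destruct (semidecidable P) as [i Hi].
  { unfold P, radius_code; cbv zeta; pr. }
  exists i; intros x; unfold U; split.
  - intros (n & Hn & Hb); apply Hi in Hn; destruct Hn as [w Hw].
    unfold P in Hw; cbv zeta in Hw.
    rewrite !andb_true_iff, negb_true_iff, Nat.eqb_eq, Nat.eqb_neq in Hw.
    destruct Hw as [[[H1 H2] H3] H4].
    exists (p1 (p1 w)), (p1 n), (p2 (p1 w)); repeat split; auto.
    + apply (fits_test_sound _ _ _ _ H3).
    + rewrite <- (pair_p n), ball_pair, H1, rational_radius_code in Hb; exact Hb.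
  - intros (t & c & l & [H1 H2] & H3 & H4).
    destruct (fits_test_complete _ _ _ H3) as [T HT].
    exists (pair c (radius_code l)); split.
    + apply Hi; exists (pair (pair t l) T); unfold P; cbv zeta.
      rewrite !p1_pair, !p2_pair, Nat.eqb_refl, H1, HT by lia.
      rewrite <- Nat.eqb_neq in H2; rewrite H2; reflexivity.
    + rewrite ball_pair, rational_radius_code; exact H4.
Qed.

(** Formal inclusion keeps [x] out of this condition: it is a c.e. property of four numbers, so the
    halting problem decides it. *)
Definition unsettled (s m c l : nat) : Prop :=
  exists t c' l', changes s m t /\ fits t c' l' /\ near c c' l' l.

(** Genericity enters here: the set of points with a name extending [s] that
    changes cell [m] is some [U X i], so [x] lies in it or has a neighbourhood
    disjoint from it. *)
Lemma generic_decides (s m : nat) (x : X) : one_generic X x -> compatible s x ->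
  exists t c l, extends s t = true /\ fits t c l /\ (ds x (al c) < (/ 2) ^ l)%R /\
    (out M t m <> out M s m \/ ~ unsettled s m c l).
Proof.
  intros Hx Hs; destruct (change_open s m) as [i Hi].
  destruct (classic (U X i x)) as [H|H].
  - apply Hi in H; destruct H as (t & c & l & [H1 H2] & H3 & H4).
    exists t, c, l; auto.
  - destruct (Hx (S i)) as (eps & He & Hc).
    destruct (compatible_extend s x eps Hs He) as (t & c & l & H1 & H2 & H3 & H4).
    exists t, c, l; repeat split; auto; right.
    intros (t' & c' & l' & H5 & H6 & H7); apply H.
    (* The centre [al c'] lies in the open set and within [eps] of [x], where bit [i] of the jump is
       constant; but [x] is outside the set. *)
    assert (HJ : J X (al c') i = J X x i).
    { apply Hc; [|lia].
      assert (Ht := dist_tri (space X) (al c') x (al c)).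
      rewrite (dist_sym _ (al c') (al c)), (dist_sym _ (al c) x) in Ht.
      unfold near in H7; assert (Hp := half_pow_pos l'); lra. }
    unfold J in HJ.
    destruct (excluded_middle_informative (U X i (al c'))) as [_|H8],
      (excluded_middle_informative (U X i x)) as [H9|_]; auto; [discriminate|].
    destruct H8; apply Hi; exists t', c', l'; repeat split; try apply H5; auto.
    rewrite dist_self; apply half_pow_pos.
Qed.

(** A change on a word compatible with [x] could be shrunk to a ball formally included in the given
    one, and that is what [unsettled] excludes. *)
Lemma settled (s m c l t : nat) (x : X) :
  ~ unsettled s m c l -> (ds x (al c) < (/ 2) ^ l)%R ->
  extends s t = true -> compatible t x -> out M t m = out M s m.
Proof.
  intros Hu Hx Hst Ht; apply Decidable.not_not; [apply Nat.eq_decidable|].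
  intros Hne; apply Hu.
  destruct (compatible_shrink t x ((/ 2) ^ l - ds x (al c))%R Ht)
    as (c' & l' & H1 & H2 & H3); [lra|].
  exists t, c', l'; repeat split; auto; unfold near.
  assert (H := dist_tri (space X) (al c) (al c') x).
  rewrite (dist_sym _ (al c) x) in H; lra.
Qed.

Lemma unsettled_index : exists f : nat -> nat, pr (fun _ v => f (v 0)) /\
  forall s m c l, halting_problem (f (pair (pair s m) (pair c l))) = 0 <->
    ~ unsettled s m c l.
Proof.
  set (P := fun a w => let s := p1 (p1 a) in let m := p2 (p1 a) in
    let t := p1 (p1 w) in let c' := p1 (p2 (p1 w)) in let l' := p2 (p2 (p1 w)) in
    extends s t && fits_test t c' l' (p2 w) &&
    near_test (p1 (p2 a)) c' l' (p2 (p2 a)) (p2 w) &&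
    negb (out M t m =? out M s m)).
  destruct (halting_problem_index P) as (f & Hf & H).
  { unfold P; cbv zeta; pr. }
  exists f; split; [exact Hf|]; intros s m c l; rewrite H.
  apply not_iff_compat; unfold P, unsettled, changes; cbv zeta; split.
  - intros [w Hw].
    repeat rewrite ?p1_pair, ?p2_pair in Hw.
    rewrite !andb_true_iff, negb_true_iff, Nat.eqb_neq in Hw.
    destruct Hw as [[[H1 H2] H3] H4].
    exists (p1 (p1 w)), (p1 (p2 (p1 w))), (p2 (p2 (p1 w))); repeat split; auto.
    + apply (fits_test_sound _ _ _ _ H2).
    + apply (near_test_sound _ _ _ _ _ H3).
  - intros (t & c' & l' & [H1 H2] & H3 & H4).
    destruct (fits_test_complete _ _ _ H3) as [T HT].
    destruct (near_test_complete _ _ _ _ H4) as [T1 HT1].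
    exists (pair (pair t (pair c' l')) (Nat.max T T1)).
    repeat rewrite ?p1_pair, ?p2_pair.
    rewrite H1, HT, HT1 by lia; rewrite <- Nat.eqb_neq in H2; rewrite H2; reflexivity.
Qed.
End Metric.

(** * The forcing construction *)

Lemma join_even q p i : join q p (2 * i) = q i.
Proof. unfold join; rewrite Nat.even_mul, Nat.div2_double; reflexivity. Qed.

Lemma join_odd q p i : join q p (S (2 * i)) = p i.
Proof.
  unfold join; rewrite Nat.even_succ, Nat.odd_mul, Nat.div2_succ_double; reflexivity.
Qed.

Section Main.
Variable X : computable_metric_space.
Variables (M_dist : machine) (f_dist : nat -> nat).
Hypothesis M_computes : forall n, exists t, halted M_dist (run M_dist (num_word n) t) /\
  forall m : nat, cell (run M_dist (num_word n) t) output_tape (Z.of_nat m) =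
    num_word (f_dist n) (Z.of_nat m).
Hypothesis f_dist_spec : forall i j k, (Rabs (rational
  (f_dist (to_nat (to_nat (i, j), k))) -
  @dist (space X) (alpha i) (alpha j)) < (/ 2) ^ k)%R.
Variables (M : machine) (idx : nat -> nat).
Hypothesis pr_idx : pr (fun _ v => idx (v 0)).
Hypothesis idx_spec : forall s m c l,
  halting_problem (idx (pair (pair s m) (pair c l))) = 0 <-> ~ unsettled X M s m c l.

(** A witness [w] codes an extension [t], a ball [(c, l)], a bound [T] for the
    distance computations, the place [N] of the given name that shows that the
    ball contains [x], and the ends in the input word of the blocks for this
    place and for the query to the halting problem. *)
Definition w_word w := p1 (p1 w).
Definition w_center w := p1 (p2 (p1 w)).
Definition w_radius w := p2 (p2 (p1 w)).
Definition w_bound w := p1 (p1 (p2 w)).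
Definition w_place w := p2 (p1 (p2 w)).
Definition w_name_end w := p1 (p2 (p2 w)).
Definition w_query_end w := p2 (p2 (p2 w)).

Definition revises (s m w : nat) : bool := negb (out M (w_word w) m =? out M s m).

(** All unbounded searches are moved into [w], so that the check is primitive recursive in the input
    word. The odd places of the joined input hold the name and the even ones the halting problem.
    The [near_test] shows that [x] is in the ball, since [x] is within 2^-N of the point at place N
    of its name. *)
Definition accepts (o : nat -> nat) (s m w : nat) : bool :=
  extends s (w_word w) &&
  fits_test M_dist (w_word w) (w_center w) (w_radius w) (w_bound w) &&
  (o (w_name_end w) =? comma) &&
  (p1 (parse o (w_name_end w)) =? S (2 * w_place w)) &&
  near_test M_dist (p2 (parse o (w_name_end w))) (w_center w) (w_place w)
    (w_radius w) (w_bound w) &&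
  (revises s m w ||
    (o (w_query_end w) =? comma) &&
    (p1 (parse o (w_query_end w)) =?
      2 * idx (pair (pair s m) (pair (w_center w) (w_radius w)))) &&
    (p2 (parse o (w_query_end w)) =? 0)).

Lemma prb_accepts :
  prb (fun o v => accepts o (p1 (p1 (v 0))) (p2 (p1 (v 0))) (p2 (v 0))).
Proof.
  unfold accepts, revises, w_word, w_center, w_radius, w_bound, w_place,
    w_name_end, w_query_end.
  assert (Hs : forall a, pr a -> prb (fun o v => o (a o v) =? comma))
    by (intros a Ha; apply prb_eqb; [apply pr_sym, Ha|pr]).
  assert (Hi : forall a, pr a -> pr (fun o v => idx (a o v)))
    by (intros a Ha; apply (pr_comp1 (fun _ => idx)); auto).
  assert (Hn := prb_near_test M_dist); assert (Hf := prb_fits_test M_dist).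
  pr.
Qed.

Section Run.
Variables (p : baire) (x : X).
Hypothesis p_name : delta p x.
Hypothesis x_generic : one_generic X x.

Let o : nat -> nat := unary (join halting_problem p).

Local Notation ds := (@dist (space X)).

Lemma accepts_sound s m w : accepts o s m w = true ->
  extends s (w_word w) = true /\ compatible X (w_word w) x /\
  (revises s m w = false -> forall t, extends s t = true -> compatible X t x ->
    out M t m = out M s m).
Proof.
  unfold accepts; rewrite !andb_true_iff, !Nat.eqb_eq.
  intros [[[[[H1 H2] H3] H4] H5] H6].
  apply (fits_test_sound X M_dist f_dist M_computes f_dist_spec) in H2.
  apply (near_test_sound X M_dist f_dist M_computes f_dist_spec) in H5.
  unfold o in H4, H5; rewrite parse_sound in H5 by exact H3.
  rewrite H4, join_odd in H5; unfold near in H5.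
  assert (Hd := delta_dist X p x (w_place w) p_name).
  assert (Hx : (ds x (alpha (w_center w)) < (/ 2) ^ w_radius w)%R).
  { assert (Ht := dist_tri (space X) x (alpha (w_center w)) (alpha (p (w_place w)))).
    lra. }
  split; [exact H1|split; [exact (fits_compatible X _ _ _ _ H2 Hx)|]].
  intros Hr t Ht Hc; rewrite Hr in H6; cbn [orb] in H6.
  rewrite !andb_true_iff, !Nat.eqb_eq in H6; destruct H6 as [[H7 H8] H9].
  unfold o in H8, H9; rewrite parse_sound in H9 by exact H7.
  rewrite H8, join_even, idx_spec in H9.
  apply (settled X M s m _ _ t x H9 Hx Ht Hc).
Qed.

(** Genericity keeps the search for a witness from running forever: either a revision exists or the
    halting problem can certify the cell. *)
Lemma accepts_complete s m : compatible X s x -> exists w, accepts o s m w = true.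
Proof.
  intros Hs.
  destruct (generic_decides X M_dist f_dist M_computes f_dist_spec M s m x x_generic Hs)
    as (t & c & l & H1 & H2 & H3 & H4).
  (* Half of the slack, because 2^-N is spent twice: on the distance from [x] to [alpha (p N)], and
     as the radius in [near]. *)
  destruct (half_pow_small (((/ 2) ^ l - ds x (alpha c)) / 2)%R) as [N HN]; [lra|].
  assert (H5 : near X (p N) c N l).
  { unfold near; assert (Hd := delta_dist X p x N p_name).
    assert (Ht := dist_tri (space X) (alpha (p N)) (alpha c) x).
    rewrite (dist_sym _ (alpha (p N)) x) in Ht; lra. }
  destruct (fits_test_complete X M_dist f_dist M_computes f_dist_spec _ _ _ H2) as [T HT].
  destruct (near_test_complete X M_dist f_dist M_computes f_dist_spec _ _ _ _ H5)
    as [T1 HT1].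
  destruct (parse_complete (join halting_problem p) (S (2 * N))) as (B1 & HB1 & E1).
  destruct (parse_complete (join halting_problem p)
    (2 * idx (pair (pair s m) (pair c l)))) as (B2 & HB2 & E2).
  exists (pair (pair t (pair c l)) (pair (pair (Nat.max T T1) N) (pair B1 B2))).
  unfold accepts, revises, w_word, w_center, w_radius, w_bound, w_place, w_name_end,
    w_query_end; repeat rewrite ?p1_pair, ?p2_pair.
  fold o in HB1, HB2, E1, E2.
  rewrite !andb_true_iff, orb_true_iff, negb_true_iff, !andb_true_iff, !Nat.eqb_eq,
    Nat.eqb_neq.
  repeat split; auto; try (apply HT; lia).
  - unfold o; rewrite parse_sound by exact HB1; fold o.
    rewrite E1, join_odd; apply HT1; lia.
  - destruct H4 as [H4|H4]; [auto|right; repeat split; auto].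
    unfold o; rewrite parse_sound by exact HB2; fold o.
    rewrite E2, join_even; apply idx_spec, H4.
Qed.

(** A state [u] codes the current word, the output cell that is being settled,
    and the next candidate for a witness. *)
Local Notation word u := (p1 (p1 u)).
Local Notation pos u := (p2 (p1 u)).

Definition accepted (o : nat -> nat) (u : nat) : bool :=
  accepts o (word u) (pos u) (p2 u).

Definition next (o : nat -> nat) (u : nat) : nat :=
  if accepted o u then
    pair (pair (w_word (p2 u))
      (if revises (word u) (pos u) (p2 u) then pos u else S (pos u))) 0
  else pair (p1 u) (S (p2 u)).

(** The codes 1 and 2 of stroke and comma are the values that [emitted] writes. A larger value would
    halt the machine; [emit_trace] excludes this. *)
Definition emit (o : nat -> nat) (u : nat) : nat :=
  if accepted o u && negb (revises (word u) (pos u) (p2 u))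
  then out M (word u) (pos u) else 0.

Definition trace (j : nat) : nat := Nat.iter j (next o) 0.

(** The second part says that no witness has been passed over, so the one given by
    [accepts_complete] is still ahead in [trace_accepted]. *)
Lemma trace_invariant j :
  compatible X (word (trace j)) x /\
  forall w, w < p2 (trace j) -> accepts o (word (trace j)) (pos (trace j)) w = false.
Proof.
  induction j as [|j [IH1 IH2]].
  (* The start state 0 codes the empty word, cell 0 and candidate 0. *)
  - change (trace 0) with (pair 0 0); rewrite p1_pair, p2_pair.
    split; [|lia]; intros k Hk; change (len (p1 0)) with 0 in Hk; lia.
  - change (trace (S j)) with (next o (trace j)).
    set (u := trace j) in *; clearbody u; unfold next.
    destruct (accepted o u) eqn:E; rewrite ?p1_pair, ?p2_pair.
    + split; [|lia].
      apply (accepts_sound _ _ _ E).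
    + split; [exact IH1|]; intros w Hw.
      destruct (Nat.eq_dec w (p2 u)) as [->|]; [exact E|apply IH2; lia].
Qed.

Lemma trace_accepted j : exists j', j <= j' /\ accepted o (trace j') = true.
Proof.
  destruct (trace_invariant j) as [H1 H2].
  destruct (accepts_complete (word (trace j)) (pos (trace j)) H1) as [w Hw].
  assert (Hl : p2 (trace j) <= w).
  { apply Nat.nlt_ge; intros Hl; rewrite H2 in Hw by exact Hl; discriminate. }
  clear H1 H2; remember (w - p2 (trace j)) as n eqn:En.
  revert j Hw Hl En; induction n as [|n IH]; intros j Hw Hl En.
  - exists j; split; [auto|]; unfold accepted.
    replace (p2 (trace j)) with w by lia; exact Hw.
  - destruct (accepted o (trace j)) eqn:E; [eauto|].
    assert (ES : trace (S j) = pair (p1 (trace j)) (S (p2 (trace j)))).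
    { change (trace (S j)) with (next o (trace j)); unfold next; rewrite E; reflexivity. }
    destruct (IH (S j)) as (j' & Hj & H); [..|exists j'; split; [lia|exact H]];
      rewrite ES, ?p1_pair, ?p2_pair; auto; lia.
Qed.

Lemma trace_step j :
  if accepted o (trace j) then
    extends (word (trace j)) (word (trace (S j))) = true /\
    (if revises (word (trace j)) (pos (trace j)) (p2 (trace j)) then
       pos (trace (S j)) = pos (trace j) /\
       out M (word (trace (S j))) (pos (trace j)) <>
         out M (word (trace j)) (pos (trace j))
     else pos (trace (S j)) = S (pos (trace j)))
  else p1 (trace (S j)) = p1 (trace j).
Proof.
  change (trace (S j)) with (next o (trace j)).
  set (u := trace j); clearbody u; unfold next.
  destruct (accepted o u) eqn:E; rewrite ?p1_pair, ?p2_pair; [|reflexivity].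
  split; [apply (accepts_sound _ _ _ E)|].
  unfold revises; destruct (Nat.eqb_spec (out M (w_word (p2 u)) (pos u))
    (out M (word u) (pos u))); cbn [negb]; auto.
Qed.

Lemma trace_word j j' : j <= j' ->
  len (word (trace j)) <= len (word (trace j')) /\
  forall i, i < len (word (trace j)) ->
    get (word (trace j')) i = get (word (trace j)) i.
Proof.
  induction 1 as [|j' Hj [IH1 IH2]]; [auto|].
  assert (H := trace_step j').
  destruct (accepted o (trace j')); [|rewrite H; auto].
  destruct H as [H _]; apply extends_iff in H; destruct H as [H1 H2].
  split; [lia|]; intros i Hi; rewrite H2 by lia; auto.
Qed.

Lemma trace_extends j j' : j < j' -> accepted o (trace j) = true ->
  extends (word (trace j)) (word (trace j')) = true.
Proof.
  intros Hj E; assert (H := trace_step j); rewrite E in H; destruct H as [H _].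
  apply extends_iff in H; destruct H as [H1 H2].
  destruct (trace_word (S j) j' Hj) as [H3 H4].
  apply extends_iff; split; [lia|]; intros i Hi; rewrite H4 by lia; auto.
Qed.

Lemma trace_long n : exists j, n <= len (word (trace j)).
Proof.
  induction n as [|n [j Hj]]; [exists 0; lia|].
  destruct (trace_accepted j) as (j' & Hj' & E).
  assert (H := trace_extends j' (S j') (Nat.lt_succ_diag_r j') E).
  apply extends_iff in H; destruct H as [H _].
  destruct (trace_word j j' Hj') as [H' _]; exists (S j'); lia.
Qed.

Lemma limit_word : exists r : baire, forall j i,
  i < len (word (trace j)) -> r i = get (word (trace j)) i.
Proof.
  assert (H : forall i, exists j, i < len (word (trace j)))
    by (intros i; destruct (trace_long (S i)) as [j Hj]; exists j; lia).
  exists (fun i => get (word (trace (proj1_sig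
    (constructive_indefinite_description _ (H i))))) i).
  intros j i Hi; destruct (constructive_indefinite_description _ (H i)) as [j' Hj'].
  cbn [proj1_sig]; destruct (le_lt_dec j j').
  - apply trace_word; auto.
  - symmetry; apply trace_word; auto; lia.
Qed.

Lemma limit_word_name (r : baire) :
  (forall j i, i < len (word (trace j)) -> r i = get (word (trace j)) i) ->
  delta r x.
Proof.
  intros Hr.
  assert (H : forall i, (ds x (alpha (r i)) < (/ 2) ^ S i)%R).
  { intros i; destruct (trace_long (S i)) as [j Hj].
    rewrite (Hr j) by lia; apply (proj1 (trace_invariant j)); lia. }
  split.
  - intros k n Hk; assert (H1 := H k); assert (H2 := H n).
    assert (Ht := dist_tri (space X) (alpha (r n)) (alpha (r k)) x).
    rewrite (dist_sym _ (alpha (r n)) x) in Ht.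
    assert (Hp : ((/ 2) ^ n <= (/ 2) ^ k)%R).
    { replace n with (k + (n - k)) by lia; rewrite pow_add.
      rewrite <- (Rmult_1_r ((/ 2) ^ k)) at 2; apply Rmult_le_compat_l.
      - apply Rlt_le, half_pow_pos.
      - rewrite <- (pow1 (n - k)); apply pow_incr; lra. }
    cbn [pow] in H1, H2; lra.
  - intros eps He; destruct (half_pow_small eps He) as [N HN]; exists N; intros n Hn.
    rewrite dist_sym; apply (Rlt_trans _ ((/ 2) ^ S n)); [apply H|].
    apply (Rle_lt_trans _ ((/ 2) ^ N)); [|exact HN].
    replace (S n) with (N + (S n - N)) by lia; rewrite pow_add.
    rewrite <- (Rmult_1_r ((/ 2) ^ N)) at 2; apply Rmult_le_compat_l.
    + apply Rlt_le, half_pow_pos.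
    + rewrite <- (pow1 (S n - N)); apply pow_incr; lra.
Qed.

(** * Convergence of the output *)

Section Limit.
Variables (r q : baire).
Hypothesis r_word : forall j i,
  i < len (word (trace j)) -> r i = get (word (trace j)) i.
Hypothesis M_produces : produces M r q.

(** Stage [j] shows the machine on [r] at the time given by the length of the word, and these times
    tend to infinity. *)
Lemma out_limit m : exists j0, forall j, j0 <= j -> out M (word (trace j)) m = unary q m.
Proof.
  destruct (M_produces m) as [t0 Ht0]; destruct (trace_long t0) as [j0 Hj0].
  exists j0; intros j Hj; rewrite (out_spec M _ m r).
  - apply Ht0; destruct (trace_word j0 j Hj); lia.
  - intros i Hi; apply (r_word j i Hi).
Qed.

(** The certified content agrees with that on all later words, which stay compatible with [x], and
    hence with the limit. *)
Lemma out_settled j : accepted o (trace j) = true ->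
  revises (word (trace j)) (pos (trace j)) (p2 (trace j)) = false ->
  out M (word (trace j)) (pos (trace j)) = unary q (pos (trace j)).
Proof.
  intros E Er; destruct (out_limit (pos (trace j))) as [j0 Hj0].
  rewrite <- (Hj0 (S (Nat.max j j0))) by lia; symmetry.
  apply (accepts_sound _ _ _ E); [exact Er|apply trace_extends; [lia|exact E]|].
  apply trace_invariant.
Qed.

Lemma emit_trace j : emit o (trace j) <= 2 /\
  emitted (emit o (trace j)) =
    map (unary q) (seq (pos (trace j)) (pos (trace (S j)) - pos (trace j))).
Proof.
  assert (H := trace_step j); unfold emit.
  destruct (accepted o (trace j)) eqn:E; cbn [andb].
  2:{ rewrite H, Nat.sub_diag; cbn; auto. }
  destruct H as [_ H].
  destruct (revises _ _ _) eqn:Er; cbn [negb].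
  - destruct H as [-> _]; rewrite Nat.sub_diag; cbn; auto.
  - rewrite (out_settled j E Er), H, unary_ustate.
    replace (S (pos (trace j)) - pos (trace j)) with 1 by lia.
    cbn [seq map]; rewrite unary_ustate; destruct (_ =? _); cbn; auto.
Qed.

Lemma pos_step j : pos (trace (S j)) = pos (trace j) \/
  pos (trace (S j)) = S (pos (trace j)).
Proof.
  assert (H := trace_step j); destruct (accepted o (trace j)); [|rewrite H; auto].
  destruct H as [_ H]; destruct (revises _ _ _); [left; apply H|auto].
Qed.

Lemma emitted_trace j :
  flat_map (fun i => emitted (emit o (trace i))) (seq 0 j) =
  map (unary q) (seq 0 (pos (trace j))).
Proof.
  induction j as [|j IH].
  - change (trace 0) with (pair 0 0); rewrite p1_pair; reflexivity.
  - rewrite seq_S, flat_map_app, IH; cbn [flat_map Nat.add]; rewrite app_nil_r.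
    rewrite (proj2 (emit_trace j)), <- map_app, <- seq_app; do 2 f_equal.
    destruct (pos_step j); lia.
Qed.

Lemma pos_unbounded m : exists j, pos (trace j) = m.
Proof.
  induction m as [|m [j Hj]].
  - exists 0; change (trace 0) with (pair 0 0); rewrite p1_pair; reflexivity.
  - apply NNPP; intros Hn.
    assert (H : forall j', j <= j' -> pos (trace j') = m).
    { induction 1 as [|j' _ IH]; [exact Hj|].
      destruct (pos_step j') as [E|E]; [congruence|].
      destruct Hn; exists (S j'); congruence. }
    (* From stage [j0] on the cell shows its limit content, so the next acceptance cannot revise it
       and must advance to cell [S m]. *)
    destruct (out_limit m) as [j0 Hj0].
    destruct (trace_accepted (Nat.max j j0)) as (j1 & Hj1 & E).
    assert (Hs := trace_step j1); rewrite E in Hs; destruct Hs as [_ Hs].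
    rewrite (H j1) in Hs by lia.
    destruct (revises _ _ _).
    + destruct Hs as [_ Hs]; rewrite !Hj0 in Hs by lia; congruence.
    + rewrite H in Hs by lia; lia.
Qed.
End Limit.
End Run.

(** [M'] does not depend on [p]. The name [r] is never written; [M'] outputs what [M] would converge
    to on it. *)
Lemma generic_machine : exists M', one_way M' /\ forall p x,
  delta p x -> one_generic X x -> exists r, delta r x /\
  forall q, produces M r q -> produces M' (join halting_problem p) q.
Proof.
  assert (Ha := prb_accepts).
  assert (Hr : prb (fun _ v => revises (p1 (p1 (v 0))) (p2 (p1 (v 0))) (p2 (v 0))))
    by (unfold revises, w_word; pr).
  assert (Hg : pr (fun o v => next o (v 0))).
  { unfold next, accepted, w_word; apply pr_if; [exact Ha| |pr].
    apply pr_pair; [apply pr_pair; [pr|apply pr_if; [exact Hr|pr|pr]]|pr]. }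
  assert (He : pr (fun o v => emit o (v 0))).
  { unfold emit, accepted; apply pr_if; [apply prb_and; [exact Ha|]|pr|pr].
    apply prb_not; exact Hr. }
  destruct Hg as [g Hg], He as [e He].
  exists (iteration g e 0); split; [apply iteration_one_way|].
  intros p x Hp Hx.
  destruct (limit_word p x Hp Hx) as [r Hr'].
  exists r; split; [apply (limit_word_name p x Hp Hx r Hr')|].
  intros q Hq m.
  set (z := join halting_problem p) in *.
  destruct (pos_unbounded p x Hp Hx r q Hr' Hq (S m)) as [j Hj].
  assert (EG : (fun s => eval (fun n => seq_word z (Z.of_nat n)) g (fun _ => s)) =
    next (unary z)).
  { apply functional_extensionality; intros s; rewrite seq_word_nat; apply Hg. }
  assert (EE : forall s, eval (fun n => seq_word z (Z.of_nat n)) e (fun _ => s) =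
    emit (unary z) s).
  { intros s; rewrite seq_word_nat; apply He. }
  assert (EO : flat_map (fun i => emitted (eval (fun n => seq_word z (Z.of_nat n)) e
      (fun _ => Nat.iter i (fun s => eval (fun n => seq_word z (Z.of_nat n)) g
        (fun _ => s)) 0))) (seq 0 j) = map (unary q) (seq 0 (S m))).
  { rewrite <- Hj, <- (emitted_trace p x Hp Hx r q Hr' Hq j).
    apply flat_map_ext; intros i; rewrite EG, EE; reflexivity. }
  destruct (iteration_output g e (seq_word z) (seq_word_symbol z) 0 m j) as [t0 Ht0].
  - intros i; rewrite EG, EE; apply (emit_trace p x Hp Hx r q Hr' Hq i).
  - rewrite EO, length_map, length_seq; lia.
  - exists t0; intros t Ht; rewrite Ht0 by exact Ht; rewrite EO.
    rewrite (nth_indep _ blank (unary q 0)) by (rewrite length_map, length_seq; lia).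
    rewrite map_nth, seq_nth by lia; reflexivity.
Qed.
End Main.

Theorem corollary5p20 (X Y : computable_metric_space) (F : pfun X Y) :
  limit_computable_map F ->
  computable_map_relative_to halting_problem (restrict F (one_generic X)).
Proof.
  intros (R & HR & M & HM).
  destruct (alpha_computable X) as (f & (Md & _ & Hd) & Hf).
  destruct (unsettled_index X Md f Hd Hf M) as (idx & pr_idx & Hidx).
  destruct (generic_machine X Md f Hd Hf M idx pr_idx Hidx) as (M' & HM' & H).
  (* The realizer need not agree with [R] on [p]: it gives the value of [R] at another name of the
     same point, which still names the same value of [F]. *)
  exists (Pfun _ _ (fun p q => produces M' (join halting_problem p) q)
    (fun p => produces_unique M' (join halting_problem p))).
  split.
  - intros p x y Hp [Hx Hy].
    destruct (H p x Hp Hx) as (r & Hr & Hq).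
    destruct (HR r x y Hr Hy) as (q & HRq & Hy').
    exists q; split; [apply Hq, HM, HRq|exact Hy'].
  - exists (Pfun _ _ (produces M') (produces_unique M')); split.
    + exists M'; split; [exact HM'|auto].
    + auto.
Qed.
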